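(* Let $(\mathcal{X},\mathcal{B})$ be a measurable space with countably generated $\sigma$-algebra $\mathcal{B}$, and let $T$ be the transition kernel of a uniformly ergodic Markov chain on $\mathcal{X}$ with stationary probability distribution $\pi$, such that $T$ is reversible with respect to $\pi$. Let $\rho\in[0,1)$ be the $L_2(\pi)$ spectral radius of $T$ (on functions of $\pi$-mean zero, as defined in the context), and let $\epsilon\in(0,\tfrac12)$. Then the mixing time $\tau_\epsilon$ satisfies $$\tau_\epsilon \;\geq\; \frac{\ln(2\epsilon)}{\ln\rho},$$ where, when $\rho=0$, this inequality is taken to mean that $\tau_\epsilon>0$.
   Context: For $n\ge 1$, $T^n$ denotes the $n$-step transition kernel of $T$. The total variation norm of a finite signed measure $\mu$ on $(\mathcal{X},\mathcal{B})$ is $\|\mu\|_{TV}=\sup_{A\in\mathcal{B}}|\mu(A)|$. The chain is uniformly ergodic if $\sup_{x\in\mathcal{X}}\|T^n(x,\cdot)-\pi\|_{TV}\to 0$ as $n\to\infty$. It is reversible with respect to $\pi$ if $\int_A T(x,B)\,\pi(dx)=\int_B T(x,A)\,\pi(dx)$ for all $A,B\in\mathcal{B}$. For $\epsilon\in(0,\tfrac12)$, the mixing time is $$\tau_\epsilon=\min\Big\{n\in\{1,2,3,\dots\}:\ \sup_{x\in\mathcal{X}}\|T^n(x,\cdot)-\pi\|_{TV}\le\epsilon\Big\},$$ which is finite for a uniformly ergodic chain. $T$ acts on $L_2(\pi)$ by $(Tf)(x)=\int f(y)\,T(x,dy)$; by reversibility this is a bounded self-adjoint operator that leaves invariant the closed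 subspace $L_2^0(\pi)=\{f\in L_2(\pi):\int f\,d\pi=0\}$. The $L_2(\pi)$ spectral radius $\rho$ of $T$ is the spectral radius of the restriction of $T$ to $L_2^0(\pi)$, i.e. $\rho=\sup\{|\lambda|:\lambda\text{ in the spectrum of }T|_{L_2^0(\pi)}\}$, with $\rho=0$ if $L_2^0(\pi)=\{0\}$. *)

(* Defs.v *)
From HB Require Import structures.
From mathcomp Require Import all_boot all_order all_algebra.
From mathcomp Require Import all_classical all_reals all_analysis.

Set Implicit Arguments.
Unset Strict Implicit.
Unset Printing Implicit Defensive.
Import Order.TTheory GRing.Theory Num.Theory.
Import numFieldNormedType.Exports.
Local Open Scope classical_set_scope.
Local Open Scope ring_scope.

Definition countably_generated d (X : measurableType d) : Prop :=
  exists2 G : set (set X), countable G & @measurable d X = <<s G >>.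

Definition tv_norm d (X : measurableType d) (R : realType)
    (nu : {charge set X -> \bar R}) : \bar R :=
  ereal_sup [set `|nu A|%E | A in measurable].

Section kernel_iter.
Context d (X : measurableType d) (R : realType) (T : R.-pker X ~> X).

Fixpoint kernel_iter (n : nat) : R.-spker X ~> X :=
  if n is m.+1 then mkcomp_noparam T (kernel_iter m)
  else kdirac (@measurable_id _ X setT).

Definition nstep (n : nat) (x : X) : set X -> \bar R := kernel_iter n x.

HB.instance Definition _ n x := Measure.on (nstep n x).

Let nstep_fin n x : fin_num_fun (nstep n x).
Proof. exact: kernel_finite_transition. Qed.

HB.instance Definition _ n x :=
  @Measure_isFinite.Build _ _ _ (nstep n x) (@nstep_fin n x).

End kernel_iter.

Section markov_chain.
Context d (X : measurableType d) (R : realType).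
Variables (T : R.-pker X ~> X) (pi : probability X R).

Definition stationary : Prop :=
  forall A, measurable A -> (\int[pi]_x T x A = pi A)%E.

Definition reversible : Prop :=
  forall A B, measurable A -> measurable B ->
    (\int[pi]_(x in A) T x B = \int[pi]_(x in B) T x A)%E.

Definition nstep_sub (n : nat) (x : X) : {charge set X -> \bar R} :=
  cadd (charge_of_finite_measure (nstep T n x))
       (copp (charge_of_finite_measure pi)).

Definition sup_tv (n : nat) : \bar R :=
  ereal_sup [set tv_norm (nstep_sub n x) | x in [set: X]].

Definition uniformly_ergodic : Prop := sup_tv n @[n --> \oo] --> 0%E.

Definition mixed (eps : R) (n : nat) : bool :=
  (0 < n)%N && (sup_tv n <= eps%:E)%E.

(* The value 0 is only a default for when the minimum does not exist. *)
Definition mixing_time (eps : R) : nat :=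
  if pselect (exists n, mixed eps n) is left h then ex_minn h else 0%N.

(* Elements of L_2(pi) are represented by real functions, identified when they
   are equal pi-almost everywhere. *)
Definition L20 : set (X -> R) :=
  [set f | f \in Lfun pi 2%:E /\ \int[pi]_x f x = 0].

(* For f in L_2(pi), the function f is T(x, .)-integrable for pi-almost every x;
   on the remaining null set, Rintegral returns a default real value. *)
Definition kernel_op (f : X -> R) (x : X) : R := \int[T x]_y f y.

(* Linearity and boundedness together imply that S maps pi-a.e. equal functions
   to pi-a.e. equal functions, so that S descends to the quotient. *)
Definition bounded_op_L20 (S : (X -> R) -> (X -> R)) : Prop :=
  [/\ forall f, L20 f -> L20 (S f),
      forall (a : R) f g, L20 f -> L20 g ->
        S (a *: f + g) = a *: S f + S g %[ae pi]
    & exists M : R, forall f, L20 f ->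
        ('N[pi]_2[EFin \o S f] <= M%:E * 'N[pi]_2[EFin \o f])%E].

Definition resolvent_set : set R :=
  [set lambda | exists2 S, bounded_op_L20 S &
     forall f, L20 f ->
       S (kernel_op f - lambda *: f) = f %[ae pi] /\
       kernel_op (S f) - lambda *: S f = f %[ae pi]].

Definition spectrum : set R := ~` resolvent_set.

(* When L20 only contains functions that vanish pi-a.e., the spectrum is empty
   and the value is sup set0 = 0. *)
Definition spectral_radius : R := sup [set `|lambda| | lambda in spectrum].

End markov_chain.

(* Main.v *)
Require Import Defs.
From mathcomp Require Import all_boot all_order all_algebra.
From mathcomp Require Import all_classical all_reals all_analysis.
From mathcomp Require Import measurable_realfun ring lra.
Import Order.TTheory GRing.Theory Num.Theory.
Import numFieldNormedType.Exports.
Set Implicit Arguments.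
Unset Strict Implicit.
Unset Printing Implicit Defensive.

(* Put D := sup_x ||T^n(x, .) - pi||. The kernel T^n(x, .) - pi has total mass at
   most 2 D in its second variable and, by reversibility, also in its first one, so
   a Schur test (Cauchy-Schwarz on simple functions, then Fatou) gives
   ||T^n f||_2 <= 2 D ||f||_2 for f of mean zero. If 2 D < |lam|^n, the Neumann
   series - \sum_m lam^-(m+1) T^m f therefore converges geometrically in L_2, hence
   pi-almost everywhere under an L_2 dominating function, and its sum inverts
   T - lam. So every spectral value satisfies |lam|^n <= 2 D, whence
   rho^n <= 2 sup_x ||T^n(x, .) - pi||, and n = tau_eps gives both claims. *)

(** The real-valued [kernel_op] makes sense only almost everywhere: on a null set it returns default
    values, which further applications of [T] could spread. The basic facts about iterates
    (composition, symmetry, stationarity) are therefore first shown for nonnegative extended-real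
    functions, where every integral exists, and then carried over to positive and negative parts.
    Null sets do no harm because [pi] is stationary. The factor 2 comes from passing from a supremum
    over sets to a total mass: the pieces on which the discrepancy T^n(x, .) - pi is positive and
    those on which it is negative contribute D each. The Schur test meets this factor once in each
    variable, so the squared norm picks up (2 D)^2. Only the single power n is controlled, whereas
    the Neumann series involves all powers of [T]. A rate q with 2 D <= q^n and q < |lam| bridges
    the gap: each block of n steps contracts by q^n, and the fewer than n leftover steps cost a
    constant that does not affect convergence. *)

(** * Monotone limits in the extended reals *)

Section ereal_nondecreasing.
Context (R : realType).
Local Open Scope classical_set_scope.
Local Open Scope ring_scope.
Local Open Scope ereal_scope.

(** Multiplication by [+oo] is discontinuous at 0. Monotonicity repairs this: either [u] vanishes
    identically, or the products are [+oo] from some index on. *)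
Lemma nd_cvgeMl (a : \bar R) (u : (\bar R)^nat) : 0 <= a ->
  (forall n, 0 <= u n) -> nondecreasing_seq u ->
  a * u n @[n --> \oo] --> a * limn u.
Proof.
move=> a0 u0 ndu; have cu : cvgn u by exact: ereal_nondecreasing_is_cvgn.
case: a a0 => [a|_|//] a0; first exact: cvgeZl.
have [uz|/existsNP[N /eqP uN]] := pselect (forall n, u n = 0).
  have -> : u = fun=> 0 by apply/funext.
  by rewrite lim_cst// mule0; exact: cvg_cst.
have uN0 : 0 < u N by rewrite lt0e uN u0.
have lim0 : 0 < limn u.
  rewrite (lt_le_trans uN0)// (cvg_lim _ (ereal_nondecreasing_cvgn ndu))//.
  by apply: ereal_sup_ubound; exists N.
rewrite gt0_mulye//; apply: cvg_near_cst; exists N => // n /= Nn.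
by rewrite gt0_mulye// (lt_le_trans uN0)//; exact: ndu.
Qed.

End ereal_nondecreasing.

(** * Induction principle for nonnegative measurable functions *)

Section nonneg_measurable.
Context d (X : measurableType d) (R : realType).
Local Open Scope classical_set_scope.
Local Open Scope ereal_scope.

Import HBNNSimple.

Lemma ge0_measurable_ind (P : (X -> \bar R) -> Prop) :
  (forall A, measurable A -> P (fun x => (\1_A x)%:E)) ->
  (forall (c : R) (f : X -> \bar R), (0 <= c)%R -> measurable_fun [set: X] f ->
     (forall x, 0 <= f x) -> P f -> P (fun x => c%:E * f x)) ->
  (forall f g : X -> \bar R, measurable_fun [set: X] f -> (forall x, 0 <= f x) -> P f ->
     measurable_fun [set: X] g -> (forall x, 0 <= g x) -> P g ->
     P (fun x => f x + g x)) ->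
  (forall f_ : (X -> \bar R)^nat, (forall n, measurable_fun [set: X] (f_ n)) ->
     (forall n x, 0 <= f_ n x) ->
     (forall x, nondecreasing_seq (f_ ^~ x)) -> (forall n, P (f_ n)) ->
     P (fun x => limn (f_ ^~ x))) ->
  forall f : X -> \bar R, measurable_fun [set: X] f -> (forall x, 0 <= f x) -> P f.
Proof.
move=> Pindic Pscale Padd Plim f mf f0.
pose f_ := nnsfun_approx measurableT mf.
have Pnn (h : {nnsfun X >-> R}) : P (fun x => (h x)%:E).
  under eq_fun => x do rewrite fimfunE fsbig_finite// -sumEFin.
  elim: (finmap.enum_fset _) => [|r s IH].
    under eq_fun => x do rewrite big_nil.
    by have := Pindic _ measurable0; under eq_fun => x do rewrite indic0.
  have mh (t : R) : measurable_fun [set: X] (fun x => (t * \1_(h @^-1` [set t]) x)%:E).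
    by apply/measurable_EFinP; apply: measurable_funM.
  have h0 (t : R) x : 0 <= (t * \1_(h @^-1` [set t]) x)%:E.
    by rewrite EFinM nnfun_muleindic_ge0.
  under eq_fun => x do rewrite big_cons.
  apply: Padd => //; last 2 first.
  - exact: emeasurable_sum.
  - by move=> x; apply: sume_ge0.
  - have [r0|r0] := leP 0%R r.
      under eq_fun => x do rewrite EFinM.
      apply: (Pscale r (fun x => (\1_(h @^-1` [set r]) x)%:E)) => //.
      - exact/measurable_EFinP.
      - exact: Pindic.
    (* A nonnegative function has an empty preimage at a negative [r], so this term is the zero
       function, an indicator of the empty set. *)
    rewrite (_ : (fun _ => _) = (fun x => (\1_(set0 : set X) x)%:E)).
      exact: Pindic.
    by apply/funext => x; rewrite preimage_nnfun0// !indic0 mulr0.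
rewrite (_ : f = fun x => limn (fun n => (f_ n x)%:E)); last first.
  by apply/funext => x; apply/esym/cvg_lim => //; exact: cvg_nnsfun_approx.
apply: Plim => //.
- by move=> n; exact/measurable_EFinP.
- by move=> n x; rewrite lee_fin.
- by move=> x a b ab; rewrite lee_fin; exact/lefP/nd_nnsfun_approx.
Qed.

End nonneg_measurable.

(** * Kernels acting on nonnegative functions, and reversibility *)

Section kernel_integral.
Context d (X : measurableType d) (R : realType).
Local Open Scope classical_set_scope.
Local Open Scope ring_scope.
Local Open Scope ereal_scope.

(** The extended-real counterpart of [kernel_op]. For nonnegative measurable [f] it involves no
    default value, so its algebra holds at every [x]. *)
Definition kernel_int (k : X -> {measure set X -> \bar R}) (f : X -> \bar R) x :=
  \int[k x]_y f y.

Lemma measurable_kernel_int (k : R.-ker X ~> X) (f : X -> \bar R) :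
  measurable_fun [set: X] f -> (forall x, 0 <= f x) ->
  measurable_fun [set: X] (kernel_int k f).
Proof.
move=> mf f0; apply: measurable_fun_integral_kernel => // U mU.
exact: measurable_kernel.
Qed.

Lemma kernel_int_ge0 (k : X -> {measure set X -> \bar R}) (f : X -> \bar R) :
  (forall x, 0 <= f x) -> forall x, 0 <= kernel_int k f x.
Proof. by move=> f0 x; exact: integral_ge0. Qed.

Lemma kernel_int_indic (k : X -> {measure set X -> \bar R}) A x :
  measurable A -> kernel_int k (fun y => (\1_A y)%:E) x = k x A.
Proof. by move=> mA; rewrite /kernel_int integral_indic// setIT. Qed.

Lemma kernel_intZ (k : X -> {measure set X -> \bar R}) (c : R) (f : X -> \bar R) x :
  (0 <= c)%R -> measurable_fun [set: X] f -> (forall x, 0 <= f x) ->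
  kernel_int k (fun y => c%:E * f y) x = c%:E * kernel_int k f x.
Proof. by move=> c0 mf f0; rewrite /kernel_int ge0_integralZl. Qed.

Lemma kernel_intD (k : X -> {measure set X -> \bar R}) (f g : X -> \bar R) x :
  measurable_fun [set: X] f -> (forall x, 0 <= f x) ->
  measurable_fun [set: X] g -> (forall x, 0 <= g x) ->
  kernel_int k (fun y => f y + g y) x = kernel_int k f x + kernel_int k g x.
Proof. by move=> mf f0 mg g0; rewrite /kernel_int ge0_integralD. Qed.

Lemma kernel_int_lim (k : X -> {measure set X -> \bar R}) (f_ : (X -> \bar R)^nat) x :
  (forall n, measurable_fun [set: X] (f_ n)) -> (forall n x, 0 <= f_ n x) ->
  (forall x, nondecreasing_seq (f_ ^~ x)) ->
  kernel_int k (fun y => limn (f_ ^~ y)) x = limn (fun n => kernel_int k (f_ n) x).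
Proof. by move=> mf f0 ndf; rewrite /kernel_int monotone_convergence. Qed.

Lemma kernel_int_nd (k : X -> {measure set X -> \bar R}) (f_ : (X -> \bar R)^nat) x :
  (forall n, measurable_fun [set: X] (f_ n)) -> (forall n x, 0 <= f_ n x) ->
  (forall x, nondecreasing_seq (f_ ^~ x)) ->
  nondecreasing_seq (fun n => kernel_int k (f_ n) x).
Proof.
move=> mf f0 ndf a b ab; apply: ge0_le_integral => // y _; exact: ndf.
Qed.

Lemma kernel_int_comp (k1 k2 : R.-spker X ~> X) (f : X -> \bar R) x :
  measurable_fun [set: X] f -> (forall x, 0 <= f x) ->
  kernel_int (mkcomp_noparam k1 k2) f x = kernel_int k1 (kernel_int k2 f) x.
Proof.
move=> mf f0; move: f mf f0 x.
apply: ge0_measurable_ind => [A mA|c f c0 mf f0 IH|f g mf f0 IHf mg g0 IHg|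
    f_ mf f0 ndf IH] x.
- rewrite kernel_int_indic//; apply: eq_integral => y _.
  by rewrite kernel_int_indic.
- rewrite kernel_intZ// IH -kernel_intZ//.
  + by apply: eq_integral => y _; rewrite kernel_intZ.
  + exact: measurable_kernel_int.
  + exact: kernel_int_ge0.
- rewrite kernel_intD// IHf IHg -kernel_intD//.
  + by apply: eq_integral => y _; rewrite kernel_intD.
  + exact: measurable_kernel_int.
  + exact: kernel_int_ge0.
  + exact: measurable_kernel_int.
  + exact: kernel_int_ge0.
- rewrite kernel_int_lim//; under eq_fun do rewrite IH.
  rewrite -kernel_int_lim//.
  + by apply: eq_integral => y _; rewrite kernel_int_lim.
  + by move=> n; exact: measurable_kernel_int.
  + by move=> n; exact: kernel_int_ge0.
  + by move=> y; exact: kernel_int_nd.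
Qed.

Lemma measurable_iter_kernel_int (k : R.-ker X ~> X) n (f : X -> \bar R) :
  measurable_fun [set: X] f -> (forall x, 0 <= f x) ->
  measurable_fun [set: X] (iter n (kernel_int k) f) /\
  forall x, 0 <= iter n (kernel_int k) f x.
Proof.
move=> mf f0; elim: n => [//|n [mn n0]] /=.
by split; [exact: measurable_kernel_int|exact: kernel_int_ge0].
Qed.

Variables (T : R.-pker X ~> X) (pi : probability X R).

Lemma kernel_int_iter n (f : X -> \bar R) x :
  measurable_fun [set: X] f -> (forall x, 0 <= f x) ->
  kernel_int (kernel_iter T n) f x = iter n (kernel_int T) f x.
Proof.
move=> mf f0; elim: n x => [|n IH] x.
  by rewrite /kernel_int /= /kdirac integral_dirac// diracT mul1e.
rewrite [LHS]kernel_int_comp//=; congr (kernel_int _ _ _).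
by apply/funext => y; rewrite IH.
Qed.

Lemma kernel_iter_setT n x : kernel_iter T n x [set: X] = 1.
Proof.
elim: n x => [|n IH] x; first by rewrite /= /kdirac diracT.
rewrite /= /kcomp_noparam/=.
under eq_integral do rewrite IH.
by rewrite integral_cst// mul1e prob_kernel.
Qed.

Hypothesis hrev : reversible T pi.

(** Reversibility is the case of two indicators. The identity extends to all [g] with [f] an
    indicator, then to all [f]; the symmetry [goodC] lets the same closure properties serve both
    times. *)
Lemma kernel_int_sym (f g : X -> \bar R) :
  measurable_fun [set: X] f -> (forall x, 0 <= f x) ->
  measurable_fun [set: X] g -> (forall x, 0 <= g x) ->
  \int[pi]_x (f x * kernel_int T g x) = \int[pi]_x (g x * kernel_int T f x).
Proof.
move=> mf f0; move: f mf f0 g.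
have goodI0 A B : measurable A -> measurable B ->
    \int[pi]_x ((\1_A x)%:E * kernel_int T (fun y => (\1_B y)%:E) x) =
    \int[pi]_x ((\1_B x)%:E * kernel_int T (fun y => (\1_A y)%:E) x).
  have E (C D : set X) : measurable C -> measurable D ->
      \int[pi]_x ((\1_C x)%:E * kernel_int T (fun y => (\1_D y)%:E) x) =
      \int[pi]_(x in C) T x D.
    move=> mC mD; rewrite [RHS]integral_mkcond; apply: eq_integral => x _.
    rewrite kernel_int_indic// patchE indicE.
    by case: ifPn => _; rewrite ?mul1e ?mul0e.
  by move=> mA mB; rewrite !E// hrev.
(* The extension sees [kernel_int T] only as an abstract operator [P]: measurable, nonnegative,
   additive, positively homogeneous and compatible with increasing limits. *)
have := kernel_int_lim T; have := kernel_int_nd T.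
have := kernel_intD T; have := kernel_intZ T.
have := kernel_int_ge0 T; have := measurable_kernel_int T.
move: (kernel_int T) goodI0 => P goodI mP P0 PZ PD Pnd Plim.
pose good (f g : X -> \bar R) :=
  \int[pi]_x (f x * P g x) = \int[pi]_x (g x * P f x).
have goodC f g : good f g -> good g f by rewrite /good => ->.
have goodZ f (c : R) g : measurable_fun [set: X] f -> (forall x, 0 <= f x) ->
    (0 <= c)%R -> measurable_fun [set: X] g -> (forall x, 0 <= g x) ->
    good f g -> good f (fun x => c%:E * g x).
  move=> mf f0 c0 mg g0; rewrite /good => fg.
  under eq_integral => x _ do rewrite PZ// muleCA.
  under [RHS]eq_integral => x _ do rewrite -muleA.
  rewrite ge0_integralZl//; last 2 first.
  + by apply: emeasurable_funM => //; exact: mP.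
  + by move=> x _; rewrite mule_ge0// P0.
  rewrite ge0_integralZl ?fg//.
  + by apply: emeasurable_funM => //; exact: mP.
  + by move=> x _; rewrite mule_ge0// P0.
have goodD f g h : measurable_fun [set: X] f -> (forall x, 0 <= f x) ->
    measurable_fun [set: X] g -> (forall x, 0 <= g x) ->
    measurable_fun [set: X] h -> (forall x, 0 <= h x) ->
    good f g -> good f h -> good f (fun x => g x + h x).
  move=> mf f0 mg g0 mh h0; rewrite /good => fg fh.
  under eq_integral => x _ do
    rewrite PD// ge0_muleDr ?P0//.
  under [RHS]eq_integral => x _ do rewrite ge0_muleDl//.
  by rewrite !ge0_integralD ?fg ?fh//; first
    [by move=> x _; rewrite mule_ge0// P0
    |by apply: emeasurable_funM => //; exact: mP].
have goodlim f (g_ : (X -> \bar R)^nat) :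
    measurable_fun [set: X] f -> (forall x, 0 <= f x) ->
    (forall n, measurable_fun [set: X] (g_ n)) -> (forall n x, 0 <= g_ n x) ->
    (forall x, nondecreasing_seq (g_ ^~ x)) -> (forall n, good f (g_ n)) ->
    good f (fun x => limn (g_ ^~ x)).
  move=> mf f0 mg g0 ndg fg; rewrite /good.
  have cg x : cvgn (g_ ^~ x) by exact: ereal_nondecreasing_is_cvgn.
  have cTg x : cvgn (fun n => P (g_ n) x).
    by apply: ereal_nondecreasing_is_cvgn; exact: Pnd.
  transitivity (limn (fun n => \int[pi]_x (f x * P (g_ n) x))).
    rewrite -monotone_convergence//.
    + apply: eq_integral => x _; rewrite Plim//.
      apply/esym/cvg_lim => //; apply: nd_cvgeMl => //.
        by move=> n; exact: P0.
      exact: Pnd.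
    + by move=> n; apply: emeasurable_funM => //; exact: mP.
    + by move=> n x _; rewrite mule_ge0// P0.
    + by move=> x _ a b ab; rewrite lee_wpmul2l//; exact: Pnd.
  transitivity (limn (fun n => \int[pi]_x (g_ n x * P f x))).
    by congr (limn _); apply/funext => n; rewrite fg.
  rewrite -monotone_convergence//.
  + apply: eq_integral => x _; rewrite muleC; under eq_fun do rewrite muleC.
    by apply/cvg_lim => //; apply: nd_cvgeMl => //; exact: P0.
  + by move=> n; apply: emeasurable_funM => //; exact: mP.
  + by move=> n x _; rewrite mule_ge0// P0.
  + by move=> x _ a b ab; rewrite lee_wpmul2r//; [exact: P0|exact: ndg].
move=> f mf f0 g mg g0.
have m1 A : measurable A -> measurable_fun [set: X] (fun x => (\1_A x)%:E : \bar R).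
  by move=> mA; exact/measurable_EFinP.
have p1 A (x : X) : 0 <= (\1_A x)%:E :> \bar R by rewrite lee_fin.
have goodIg A : measurable A -> good (fun x => (\1_A x)%:E) g.
  move=> mA; move: g mg g0; apply: ge0_measurable_ind.
  - by move=> B mB; exact: goodI.
  - by move=> c g c0 mg g0 Ag; apply: goodZ => //; exact: m1.
  - by move=> g h mg g0 Ag mh h0 Ah; apply: goodD => //; exact: m1.
  - by move=> g_ mg g0 ndg Ag; apply: goodlim => //; exact: m1.
move: f mf f0; apply: ge0_measurable_ind.
- by move=> A mA; exact: goodIg.
- by move=> c f c0 mf f0 fg; apply/goodC/goodZ => //; exact: goodC.
- by move=> f h mf f0 fg mh h0 hg; apply/goodC/goodD => //; exact: goodC.
- by move=> f_ mf f0 ndf fg; apply/goodC/goodlim => // n; exact: goodC.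
Qed.

(** Pair [f] with the constant 1 in [kernel_int_sym]; a probability kernel fixes that constant. *)
Lemma kernel_int_stationary (f : X -> \bar R) :
  measurable_fun [set: X] f -> (forall x, 0 <= f x) ->
  \int[pi]_x kernel_int T f x = \int[pi]_x f x.
Proof.
move=> mf f0.
transitivity (\int[pi]_x (cst 1 x * kernel_int T f x)).
  by apply: eq_integral => x _; rewrite mul1e.
rewrite kernel_int_sym//; apply: eq_integral => x _.
by rewrite /kernel_int integral_cst// mul1e prob_kernel mule1.
Qed.

Lemma iter_kernel_int_stationary n (f : X -> \bar R) :
  measurable_fun [set: X] f -> (forall x, 0 <= f x) ->
  \int[pi]_x iter n (kernel_int T) f x = \int[pi]_x f x.
Proof.
move=> mf f0; elim: n => [//|n IH] /=; rewrite kernel_int_stationary//.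
- exact: (measurable_iter_kernel_int T n mf f0).1.
- exact: (measurable_iter_kernel_int T n mf f0).2.
Qed.

Lemma iter_kernel_int_sym n (f g : X -> \bar R) :
  measurable_fun [set: X] f -> (forall x, 0 <= f x) ->
  measurable_fun [set: X] g -> (forall x, 0 <= g x) ->
  \int[pi]_x (f x * iter n (kernel_int T) g x) =
  \int[pi]_x (g x * iter n (kernel_int T) f x).
Proof.
move=> + + mg g0; elim: n f => [|n IH] f mf f0.
  by apply: eq_integral => x _; rewrite muleC.
have [mn n0] := measurable_iter_kernel_int T n mg g0.
rewrite /= kernel_int_sym//.
under eq_integral do rewrite muleC.
rewrite IH//; first by apply: eq_integral => x _; rewrite -iterSr.
- exact: measurable_kernel_int.
- exact: kernel_int_ge0.
Qed.

Lemma kernel_iter_reversible n A B : measurable A -> measurable B ->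
  \int[pi]_(x in A) kernel_iter T n x B = \int[pi]_(x in B) kernel_iter T n x A.
Proof.
move=> mA mB.
have m1 C : measurable C -> measurable_fun [set: X] (fun x => (\1_C x)%:E : \bar R).
  by move=> mC; exact/measurable_EFinP.
have p1 C (x : X) : 0 <= (\1_C x)%:E :> \bar R by rewrite lee_fin.
have E (C D : set X) : measurable C -> measurable D ->
    \int[pi]_(x in C) kernel_iter T n x D =
    \int[pi]_x ((\1_C x)%:E * iter n (kernel_int T) (fun y => (\1_D y)%:E) x).
  move=> mC mD; rewrite integral_mkcond; apply: eq_integral => x _.
  rewrite -kernel_int_iter ?kernel_int_indic//; last exact: m1.
  by rewrite patchE indicE; case: ifPn => _; rewrite ?mul1e ?mul0e.
by rewrite !E// iter_kernel_int_sym//; exact: m1.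
Qed.

End kernel_integral.

(** * Cauchy-Schwarz with weights *)

Section weighted_cauchy_schwarz.
Context (R : realDomainType) (I : Type).
Local Open Scope ring_scope.

(** Lagrange's identity, one index at a time: adding [i] raises the difference of the two sides by
    [w i * \sum_j w j * (x j - x i) ^+ 2]. It serves twice, with discrepancies as weights and with
    geometric weights. *)
Lemma weighted_cauchy_schwarz (s : seq I) (w x : I -> R) : (forall i, 0 <= w i) ->
  (\sum_(i <- s) w i * x i) ^+ 2 <=
  (\sum_(i <- s) w i) * (\sum_(i <- s) w i * x i ^+ 2).
Proof.
move=> w0; elim: s => [|i s IH]; first by rewrite !big_nil mul0r expr0n.
rewrite !big_cons.
have := IH; set S := \sum_(j <- s) w j * x j; set W := \sum_(j <- s) w j.
set Q := \sum_(j <- s) w j * x j ^+ 2 => SWQ.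
have : 0 <= \sum_(j <- s) w j * (x j - x i) ^+ 2.
  by apply: sumr_ge0 => j _; rewrite mulr_ge0 ?sqr_ge0.
have -> : \sum_(j <- s) w j * (x j - x i) ^+ 2 = Q - 2 * x i * S + x i ^+ 2 * W.
  rewrite /Q /S /W !mulr_sumr -sumrB -big_split/=.
  by apply: eq_bigr => j _; ring.
move=> /(mulr_ge0 (w0 i)) wi.
rewrite -subr_ge0 (_ : _ - _ = w i * (Q - 2 * x i * S + x i ^+ 2 * W) +
   (W * Q - S ^+ 2)); last by ring.
by rewrite addr_ge0// subr_ge0.
Qed.

End weighted_cauchy_schwarz.

(** * Schur test for the discrepancy kernel on simple functions *)

Section simple_function_bound.
Context d (X : measurableType d) (R : realType).
Local Open Scope classical_set_scope.
Local Open Scope ring_scope.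

Import HBSimple.

Lemma Rintegral_sfun (mu : {finite_measure set X -> \bar R}) (h : {sfun X >-> R}) :
  \int[mu]_x h x =
  \sum_(r <- finmap.enum_fset (fset_set (range h))) r * fine (mu (h @^-1` [set r])).
Proof.
rewrite /Rintegral.
have mh r : measurable (h @^-1` [set r]) by exact: measurable_sfunP.
have ih r : mu.-integrable setT (fun x => (r * \1_(h @^-1` [set r]) x)%:E).
  under eq_fun do rewrite EFinM.
  by apply: integrableZl => //; exact: integrable_indic.
under eq_integral => x _ do rewrite fimfunE fsbig_finite// -sumEFin.
rewrite integral_sum// -sum_fine; last first.
  by move=> r _; exact: integrable_fin_num.
apply: eq_bigr => r _.
under eq_integral => x _ do rewrite EFinM.
rewrite integralZl//; last exact: integrable_indic.
rewrite integral_indic// setIT fineM//.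
exact: fin_num_measure.
Qed.

Lemma fine_measure_bigsetU (mu : {finite_measure set X -> \bar R}) (I : choiceType)
    (s : seq I) (F : I -> set X) :
  uniq s -> (forall i, measurable (F i)) -> trivIset [set: I] F ->
  fine (mu (\big[setU/set0]_(i <- s) F i)) = \sum_(i <- s) fine (mu (F i)).
Proof.
move=> us mF tF; rewrite sum_fine; last by move=> i _; exact: fin_num_measure.
rewrite [in LHS]fsbig_seq// measure_fsbig//; last exact: sub_trivIset tF.
by rewrite -fsbig_seq.
Qed.

(** The pieces where [mu] exceeds [nu] form one measurable set, the others a second one; each set
    contributes at most [D]. This is the Schur bound in the second variable. *)
Lemma sum_abs_discrepancy (mu nu : {finite_measure set X -> \bar R}) (D : R)
    (I : choiceType) (s : seq I) (F : I -> set X) :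
  (forall A, measurable A -> `|fine (mu A) - fine (nu A)| <= D) ->
  uniq s -> (forall i, measurable (F i)) -> trivIset [set: I] F ->
  \sum_(i <- s) `|fine (mu (F i)) - fine (nu (F i))| <= 2 * D.
Proof.
move=> hD us mF tF.
pose a i := fine (mu (F i)) - fine (nu (F i)).
have half (p : pred I) : `|\sum_(i <- s | p i) a i| <= D.
  rewrite -big_filter sumrB -!fine_measure_bigsetU ?filter_uniq//; apply: hD.
  by apply: bigsetU_measurable.
rewrite (bigID (fun i => 0 <= a i))/= mulr_natl mulr2n.
apply: lerD.
  apply: le_trans (half (fun i => 0 <= a i)).
  rewrite ger0_norm; last exact: sumr_ge0.
  by apply: ler_sum => i ai; rewrite ger0_norm.
apply: le_trans (half (fun i => ~~ (0 <= a i))).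
rewrite -normrN -sumrN ger0_norm; last first.
  by apply: sumr_ge0 => i; rewrite oppr_ge0 -ltNge => /ltW.
by apply: ler_sum => i; rewrite -ltNge => ai; rewrite ltr0_norm.
Qed.

Variables (T : R.-pker X ~> X) (pi : probability X R) (n : nat) (D : R).
Hypothesis hrev : reversible T pi.

Let nu x A := fine (nstep T n x A) - fine (pi A).

Hypothesis hD : forall x A, measurable A -> `|nu x A| <= D.

Lemma measurable_discrepancy A : measurable A ->
  measurable_fun [set: X] (nu ^~ A).
Proof.
move=> mA; apply: measurable_funB => //; apply: measurableT_comp => //.
exact: (measurable_kernel (kernel_iter T n)).
Qed.

Lemma nstep_le1 x A : measurable A -> (nstep T n x A <= 1)%E.
Proof.
move=> mA; rewrite -(kernel_iter_setT T n x).
by apply: (le_measure (nstep T n x)) => //; rewrite inE.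
Qed.

(** The trivial choice [D = 1], which bounds every power of [T] on L_2 without any mixing. *)
Lemma discrepancy_le1 x A : measurable A -> `|nu x A| <= 1.
Proof.
move=> mA; rewrite ler_norml /nu.
have h01 (z : \bar R) : (0 <= z)%E -> (z <= 1)%E -> 0 <= fine z <= 1.
  by case: z => //= r; rewrite !lee_fin => -> ->.
have /andP[? ?] := h01 _ (measure_ge0 (nstep T n x) A) (nstep_le1 x mA).
have /andP[? ?] := h01 _ (measure_ge0 pi A) (probability_le1 pi mA).
by apply/andP; split; lra.
Qed.

Lemma integrable_nstep A B : measurable A -> measurable B ->
  pi.-integrable B (fun x => nstep T n x A).
Proof.
move=> mA mB; apply: (@le_integrable _ _ _ _ _ _ _ (cst 1%E)) => //.
- by apply: measurable_funTS; exact: (measurable_kernel (kernel_iter T n)).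
- by move=> x _; rewrite gee0_abs// gee0_abs//= nstep_le1.
- exact: finite_measure_integrable_cst.
Qed.

Lemma integrable_discrepancy A B : measurable A -> measurable B ->
  pi.-integrable B (EFin \o nu ^~ A).
Proof.
move=> mA mB; rewrite [X in _.-integrable _ X](_ : _ =
    (fun x => nstep T n x A - pi A)%E); last first.
  by apply/funext => x /=; rewrite EFinB !fineK// fin_num_measure.
apply: integrableB => //; first exact: integrable_nstep.
rewrite -[pi A]fineK ?fin_num_measure//.
exact: finite_measure_integrable_cst.
Qed.

Lemma discrepancy_sym A B : measurable A -> measurable B ->
  \int[pi]_(x in A) nu x B = \int[pi]_(x in B) nu x A.
Proof.
have E C E : measurable C -> measurable E -> \int[pi]_(x in C) nu x E =
    fine (\int[pi]_(x in C) nstep T n x E)%E - fine (pi E) * fine (pi C).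
  move=> mC mE; rewrite RintegralB//.
  - rewrite Rintegral_cst//; congr (fine _ - _).
    by apply: eq_integral => x _; rewrite fineK// fin_num_measure.
  - apply: eq_integrable (integrable_nstep mE mC) => // x _ /=.
    by rewrite fineK// fin_num_measure.
  - exact: finite_measure_integrable_cst.
by move=> mA mB; rewrite !E// mulrC; congr (fine _ - _); exact: kernel_iter_reversible.
Qed.

(** Bounding directly would give the factor [pi B]. Symmetry first exchanges the set of integration
    with the target set, so that [pi A] appears. *)
Lemma le_discrepancy_integral A B : measurable A -> measurable B ->
  `|\int[pi]_(x in B) nu x A| <= D * fine (pi A).
Proof.
move=> mA mB; rewrite discrepancy_sym//.
apply: le_trans (le_normr_Rintegral mA (integrable_discrepancy mB mA)) _.
rewrite -Rintegral_cst//; apply: le_Rintegral => //.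
- exact: integrable_norm (integrable_discrepancy mB mA).
- exact: finite_measure_integrable_cst.
- by move=> x _; exact: hD.
Qed.

(** The Schur bound in the first variable: [le_discrepancy_integral] contributes one [D] on the set
    where [nu x A] is nonnegative and one on its complement. *)
Lemma integral_abs_discrepancy A : measurable A ->
  \int[pi]_x `|nu x A| <= 2 * D * fine (pi A).
Proof.
move=> mA; pose P := [set x | 0 <= nu x A].
have mP : measurable P.
  rewrite (_ : P = [set: X] `&` nu ^~ A @^-1` `[0, +oo[).
    exact: measurable_discrepancy.
  by apply/seteqP; split => x /=; rewrite /P /= in_itv/= andbT// => -[].
have mN : measurable (~` P) by exact: measurableC.
rewrite -(setUv P) Rintegral_setU//; last 2 first.
- by rewrite setUv; exact: integrable_norm (integrable_discrepancy mA measurableT).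
- by apply/disj_set2P; rewrite setICr.
rewrite -mulrA mulr_natl mulr2n; apply: lerD.
  apply: le_trans (le_discrepancy_integral mA mP).
  apply: le_trans (ler_norm _); rewrite le_eqVlt; apply/orP; left; apply/eqP.
  by apply: eq_Rintegral => x; rewrite inE => Px; rewrite ger0_norm.
apply: le_trans (le_discrepancy_integral mA mN).
rewrite -normrN; apply: le_trans (ler_norm _).
rewrite -mulN1r -RintegralZl//; last exact: integrable_discrepancy.
rewrite le_eqVlt; apply/orP; left; apply/eqP.
apply: eq_Rintegral => x; rewrite inE /P/= => /negP; rewrite -ltNge => Px.
by rewrite ltr0_norm// mulN1r.
Qed.

(* Interpolation between L_oo and L_1: with A_r := h @^-1` [set r], Cauchy-Schwarz
   with weights |nu x A_r| of total mass at most 2 D bounds the square by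
   2 D \sum_r r^2 |nu x A_r|, and reversibility gives \int |nu x A_r| pi(dx) <=
   2 D pi(A_r). Working with simple functions avoids the measurability in x of
   the total variation of nu x. *)
Lemma sfun_contraction (h : {sfun X >-> R}) :
  (\int[pi]_x (((\int[nstep T n x]_y h y) - \int[pi]_y h y) ^+ 2)%:E <=
   ((2 * D) ^+ 2)%:E * \int[pi]_x (h x ^+ 2)%:E)%E.
Proof.
set s := finmap.enum_fset (fset_set (range h)).
have us : uniq s by exact: finmap.fset_uniq.
have mh r : measurable (h @^-1` [set r]) by exact: measurable_sfunP.
have th : trivIset [set: R] (fun r => h @^-1` [set r]).
  exact: trivIset_preimage1.
have D0 : 0 <= D by exact: le_trans (hD point measurable0).
pose a x r : R := `|nu x (h @^-1` [set r])|.
have hle x : ((\int[nstep T n x]_y h y) - \int[pi]_y h y) ^+ 2 <=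
    2 * D * \sum_(r <- s) r ^+ 2 * a x r.
  rewrite !Rintegral_sfun -/s -sumrB -[leLHS]real_normK ?num_real//.
  apply: (@le_trans _ _ ((\sum_(r <- s) a x r * `|r|) ^+ 2)).
    rewrite lerXn2r ?nnegrE ?sumr_ge0//.
      by move=> r _; rewrite mulr_ge0// normr_ge0.
    apply: (le_trans (ler_norm_sum _ _ _)); apply: ler_sum => r _.
    by rewrite -mulrBr normrM mulrC.
  apply: (le_trans (weighted_cauchy_schwarz _ _ (fun r => normr_ge0 _))).
  under [X in _ * X <= _]eq_bigr => r _ do rewrite real_normK ?num_real// mulrC.
  apply: ler_wpM2r.
    by apply: sumr_ge0 => r _; rewrite mulr_ge0// sqr_ge0.
  exact: (sum_abs_discrepancy (mu := nstep T n x) (nu := pi) (hD x) us mh th).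
have ia r : pi.-integrable [set: X] (EFin \o a ^~ r).
  exact: integrable_norm (integrable_discrepancy (mh r) measurableT).
have ma r : measurable_fun [set: X] (a ^~ r).
  by apply: measurableT_comp => //; exact: measurable_discrepancy.
have mterm r : measurable_fun [set: X] (fun x => (r ^+ 2 * a x r)%:E).
  by apply/measurable_EFinP; apply: measurable_funM.
have termge0 r x : (0 <= (r ^+ 2 * a x r)%:E)%E.
  by rewrite lee_fin mulr_ge0 ?sqr_ge0 ?normr_ge0.
apply: (@le_trans _ _ (\int[pi]_x
    ((2 * D)%:E * \sum_(r <- s) (r ^+ 2 * a x r)%:E))%E).
  apply: ge0_le_integral => //.
  - by move=> x _; rewrite lee_fin sqr_ge0.
  - apply/measurable_EFinP; apply: measurable_funX; apply: measurable_funB => //.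
    under eq_fun do rewrite Rintegral_sfun.
    apply: measurable_sum => r; apply: measurable_funM => //.
    by apply: measurableT_comp => //; exact: (measurable_kernel (kernel_iter T n)).
  - by apply: measurable_funeM; exact: emeasurable_sum.
  - by move=> x _; rewrite sumEFin -EFinM lee_fin.
rewrite ge0_integralZl//; last 3 first.
- exact: emeasurable_sum.
- by move=> x _; exact: sume_ge0.
- by rewrite lee_fin mulr_ge0.
rewrite ge0_integral_sum//.
rewrite (_ : ((2 * D) ^+ 2)%:E = (2 * D)%:E * (2 * D)%:E)%E; last first.
  by rewrite -EFinM expr2.
rewrite -[leRHS]muleA lee_wpmul2l ?lee_fin ?mulr_ge0//.
have -> : (\int[pi]_x (h x ^+ 2)%:E =
    \sum_(r <- s) (r ^+ 2)%:E * pi (h @^-1` [set r]))%E.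
  under eq_integral => x _.
    have -> : (h x ^+ 2)%:E = (\sum_(r <- s) (r ^+ 2 * \1_(h @^-1` [set r]) x)%:E)%E.
      rewrite sumEFin; congr EFin; rewrite (bigD1_seq (h x))//=; last first.
        by rewrite /s in_fset_set// inE; exists x.
      rewrite indicE mem_set// mulr1 big1 ?addr0// => r rhx.
      by rewrite indicE memNset ?mulr0// => /= E; rewrite E eqxx in rhx.
    over.
  rewrite ge0_integral_sum//.
  - apply: eq_bigr => r _; under eq_integral do rewrite EFinM.
    rewrite ge0_integralZl// ?integral_indic ?setIT// ?lee_fin ?sqr_ge0//.
    exact/measurable_EFinP.
  - by move=> r; apply/measurable_EFinP; apply: measurable_funM.
  - by move=> r x _; rewrite lee_fin mulr_ge0// sqr_ge0.
rewrite ge0_sume_distrr; last by move=> r _; rewrite mule_ge0// lee_fin sqr_ge0.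
apply: lee_sum => r _; under eq_integral do rewrite EFinM.
rewrite ge0_integralZl//; last by rewrite lee_fin sqr_ge0.
- rewrite muleCA lee_wpmul2l ?lee_fin ?sqr_ge0//.
  have := integral_abs_discrepancy (mh r).
  rewrite -lee_fin EFinM /Rintegral fineK; last exact: (integrable_fin_num measurableT (ia r)).
  by rewrite fineK// fin_num_measure.
- exact/measurable_EFinP/ma.
- by move=> x _; rewrite lee_fin normr_ge0.
Qed.

End simple_function_bound.

(** * From nonnegative functions to integrable ones, almost everywhere *)

Section kernel_operator.
Context d (X : measurableType d) (R : realType).
Local Open Scope classical_set_scope.
Local Open Scope ring_scope.
Variables (T : R.-pker X ~> X) (pi : probability X R).
Hypothesis hrev : reversible T pi.

Let kernel_stationary A : measurable A -> (\int[pi]_x T x A = pi A)%E.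
Proof.
move=> mA; have mI : measurable_fun [set: X] (fun x => (\1_A x)%:E : \bar R).
  exact/measurable_EFinP.
transitivity (\int[pi]_x (\1_A x)%:E)%E; last by rewrite integral_indic// setIT.
rewrite -(kernel_int_stationary hrev mI); last by move=> x; rewrite lee_fin.
by apply: eq_integral => x _; rewrite kernel_int_indic.
Qed.

(** If [pi N = 0], stationarity makes the integral of [T x N] vanish, so [N] is null for [T x] at
    almost every [x]. Hence [kernel_op] respects almost everywhere equality. *)
Lemma ae_kernel (Q : X -> Prop) : {ae pi, forall x, Q x} ->
  {ae pi, forall x, {ae T x, forall y, Q y}}.
Proof.
move=> [N [mN piN QN]].
have : {ae pi, forall x, [set: X] x -> T x N = 0%E}.
  apply/(ae_eq_integral_abs pi measurableT); first exact: measurable_kernel.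
  rewrite -piN -(kernel_stationary mN); apply: eq_integral => x _.
  by rewrite gee0_abs.
by apply: filterS => x TN; exists N; split => //; exact: TN.
Qed.

Lemma ae_fin_num (h : X -> \bar R) : measurable_fun [set: X] h ->
  (forall x, 0 <= h x)%E -> (\int[pi]_x h x < +oo)%E ->
  {ae pi, forall x, h x \is a fin_num}.
Proof.
move=> mh h0 hoo; have ih : pi.-integrable [set: X] h.
  apply/integrableP; split => //.
  by under eq_integral => x _ do rewrite gee0_abs//.
by apply: filterS (integrable_ae measurableT ih) => x; exact.
Qed.

Let abs_fine_le (z : \bar R) : (`|fine z|%:E <= `|z|)%E.
Proof. by case: z => [r| |] //=; rewrite normr0 leey. Qed.

Lemma integrable_measurable (f : X -> R) :
  pi.-integrable [set: X] (EFin \o f) -> measurable_fun [set: X] f.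
Proof. by move=> /measurable_int/measurable_EFinP. Qed.

Let norm_meas (f : X -> R) : pi.-integrable [set: X] (EFin \o f) ->
  measurable_fun [set: X] (fun x => `|f x|%:E) /\
  (\int[pi]_x `|f x|%:E < +oo)%E.
Proof.
move=> /integrableP[mf foo]; split => //.
by apply/measurable_EFinP; apply: measurableT_comp => //; exact/measurable_EFinP.
Qed.

(** The n-step integral of |f| has the same finite [pi]-integral as |f|, hence is finite almost
    everywhere. *)
Lemma ae_integrable_nstep n (f : X -> R) :
  pi.-integrable [set: X] (EFin \o f) ->
  {ae pi, forall x, (nstep T n x).-integrable [set: X] (EFin \o f)}.
Proof.
move=> fi; have [mf foo] := norm_meas fi.
have f0 x : (0 <= `|f x|%:E)%E by rewrite lee_fin.
have [mn n0] := measurable_iter_kernel_int T n mf f0.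
have := ae_fin_num mn n0; rewrite iter_kernel_int_stationary// => /(_ foo).
apply: filterS => x; rewrite -kernel_int_iter// => fx.
apply/integrableP; split; first exact: measurable_int fi.
by rewrite -ge0_fin_numE// integral_ge0.
Qed.

Lemma ae_integrable_kernel (f : X -> R) :
  pi.-integrable [set: X] (EFin \o f) ->
  {ae pi, forall x, (T x).-integrable [set: X] (EFin \o f)}.
Proof.
move=> fi; have [mf foo] := norm_meas fi.
have f0 x : (0 <= `|f x|%:E)%E by rewrite lee_fin.
have mT := measurable_kernel_int T mf f0.
have := ae_fin_num mT (kernel_int_ge0 T f0).
rewrite (kernel_int_stationary hrev)// => /(_ foo).
apply: filterS => x fx.
apply/integrableP; split; first exact: measurable_int fi.
by rewrite -ge0_fin_numE// integral_ge0.
Qed.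

Lemma measurable_kernel_op (f : X -> R) : measurable_fun [set: X] f ->
  measurable_fun [set: X] (kernel_op T f).
Proof.
move=> mf; apply: measurableT_comp => //=.
under eq_fun do rewrite integralE.
have mf' : measurable_fun [set: X] (EFin \o f) by exact/measurable_EFinP.
apply: emeasurable_funB; apply: measurable_kernel_int => //.
- exact: measurable_funepos.
- exact: measurable_funeneg.
Qed.

Lemma integrable_kernel_op (f : X -> R) :
  pi.-integrable [set: X] (EFin \o f) ->
  pi.-integrable [set: X] (EFin \o kernel_op T f).
Proof.
move=> fi; have [mf foo] := norm_meas fi.
have mf' := integrable_measurable fi.
have f0 x : (0 <= `|f x|%:E)%E by rewrite lee_fin.
apply/integrableP; split; first exact/measurable_EFinP/measurable_kernel_op.
apply: le_lt_trans foo; rewrite -(kernel_int_stationary hrev mf f0).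
apply: ge0_le_integral => //.
- apply: measurableT_comp => //.
  exact/measurable_EFinP/measurable_kernel_op.
- exact: measurable_kernel_int.
- move=> x _; have := le_abse_integral (T x) measurableT (measurable_int pi fi).
  apply: le_trans.
  exact: abs_fine_le.
Qed.

Lemma eq_kernel_op (f g : X -> R) : measurable_fun [set: X] f ->
  measurable_fun [set: X] g -> {ae pi, forall x, f x = g x} ->
  {ae pi, forall x, kernel_op T f x = kernel_op T g x}.
Proof.
move=> mf mg /ae_kernel; apply: filterS => x fg.
rewrite /kernel_op /Rintegral; congr fine; apply: ae_eq_integral => //.
- exact/measurable_EFinP.
- exact/measurable_EFinP.
- by apply: filterS fg => y -> _.
Qed.

Lemma kernel_op_lin (a : R) (f g : X -> R) :
  pi.-integrable [set: X] (EFin \o f) -> pi.-integrable [set: X] (EFin \o g) ->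
  {ae pi, forall x, kernel_op T (fun y => a * f y + g y) x =
                    a * kernel_op T f x + kernel_op T g x}.
Proof.
move=> fi gi; have := ae_integrable_kernel fi.
apply: filterS2 (ae_integrable_kernel gi) => x gx fx.
rewrite /kernel_op RintegralD// ?RintegralZl//.
by rewrite (_ : _ \o _ = fun y => a%:E * (f y)%:E)%E//; exact: integrableZl.
Qed.

(** The set where [h] is infinite, and [fine] loses information, is [pi]-null, hence [T x]-null for
    almost every [x]. *)
Lemma kernel_op_fine (h : X -> \bar R) : measurable_fun [set: X] h ->
  (forall x, 0 <= h x)%E -> (\int[pi]_x h x < +oo)%E ->
  {ae pi, forall x, kernel_op T (fine \o h) x = fine (kernel_int T h x)}.
Proof.
move=> mh h0 hoo; have := ae_kernel (ae_fin_num mh h0 hoo).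
apply: filterS => x hx; rewrite /kernel_op /Rintegral; congr fine.
apply: ae_eq_integral => //.
- by apply/measurable_EFinP; exact: measurableT_comp.
- by apply: filterS hx => y hy _ /=; rewrite fineK.
Qed.

Lemma integrable_iter_kernel_op n (f : X -> R) :
  pi.-integrable [set: X] (EFin \o f) ->
  pi.-integrable [set: X] (EFin \o iter n (kernel_op T) f).
Proof. by move=> fi; elim: n => [//|n IH]; exact: integrable_kernel_op. Qed.

Lemma iter_kernel_op_lin n (a : R) (f g : X -> R) :
  pi.-integrable [set: X] (EFin \o f) -> pi.-integrable [set: X] (EFin \o g) ->
  {ae pi, forall x, iter n (kernel_op T) (fun y => a * f y + g y) x =
     a * iter n (kernel_op T) f x + iter n (kernel_op T) g x}.
Proof.
move=> fi gi.
have li u v : pi.-integrable [set: X] (EFin \o u) ->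
    pi.-integrable [set: X] (EFin \o v) ->
    pi.-integrable [set: X] (EFin \o (fun y => a * u y + v y)).
  move=> ui vi.
  rewrite (_ : _ \o _ = (fun y => a%:E * (u y)%:E) \+ (EFin \o v))%E//.
  by apply: integrableD => //; exact: integrableZl.
elim: n => [|n IH]; first exact: aeW.
have nf := integrable_iter_kernel_op n fi.
have ng := integrable_iter_kernel_op n gi.
have := kernel_op_lin a nf ng.
have := eq_kernel_op (integrable_measurable (integrable_iter_kernel_op n (li _ _ fi gi)))
  (integrable_measurable (li _ _ nf ng)) IH.
by apply: filterS2 => x /= -> ->.
Qed.

Lemma iter_kernel_op_fine n (h : X -> \bar R) : measurable_fun [set: X] h ->
  (forall x, 0 <= h x)%E -> (\int[pi]_x h x < +oo)%E ->
  {ae pi, forall x, iter n (kernel_op T) (fine \o h) x = fine (iter n (kernel_int T) h x)}.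
Proof.
move=> mh h0 hoo; elim: n => [|n IH]; first exact: aeW.
have [mn n0] := measurable_iter_kernel_int T n mh h0.
have noo : (\int[pi]_x iter n (kernel_int T) h x < +oo)%E.
  by rewrite iter_kernel_int_stationary.
have mf : measurable_fun [set: X] (iter n (kernel_op T) (fine \o h)).
  elim: (n) => [|m]; last exact: measurable_kernel_op.
  exact: measurableT_comp.
have mg : measurable_fun [set: X] (fine \o iter n (kernel_int T) h).
  exact: measurableT_comp.
have := kernel_op_fine mn n0 noo.
by apply: filterS2 (eq_kernel_op mf mg IH) => x /= -> ->.
Qed.

(** The left side may meet default values at each of its [n] integrations, the right side integrates
    once. On [f^\+] and [f^\-] both agree almost everywhere with the iterated [kernel_int]. *)
Lemma iter_kernel_opE n (f : X -> R) :
  pi.-integrable [set: X] (EFin \o f) ->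
  {ae pi, forall x, iter n (kernel_op T) f x = \int[nstep T n x]_y f y}.
Proof.
move=> fi.
have ip := integrable_funrpos measurableT fi.
have im := integrable_funrneg measurableT fi.
have fE : f = fun x => -1 * f^\- x + f^\+ x.
  by rewrite -[LHS]funrposBneg; apply/funext => x; rewrite /= mulN1r addrC.
have nn (g : X -> R) : (forall x, 0 <= g x) ->
    pi.-integrable [set: X] (EFin \o g) ->
    {ae pi, forall x, iter n (kernel_op T) g x = \int[nstep T n x]_y g y /\
      (nstep T n x).-integrable [set: X] (EFin \o g)}.
  move=> g0 gi; have g0' x : (0 <= (EFin \o g) x)%E by rewrite lee_fin.
  have mg := measurable_int pi gi.
  apply: filterS2 (iter_kernel_op_fine n mg g0' (integrable_lty measurableT gi))
    (ae_integrable_nstep n gi) => x /= -> gx.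
  by split => //; rewrite -kernel_int_iter.
have := iter_kernel_op_lin n (-1) im ip; rewrite -fE => lin.
apply: filterS3 (nn _ (funrpos_ge0 f) ip) (nn _ (funrneg_ge0 f) im) lin.
move=> x /= [-> pn] [-> mn] ->.
rewrite [in RHS]fE RintegralD ?RintegralZl//.
by rewrite (_ : _ \o _ = fun y => (-1)%:E * (f^\- y)%:E)%E//; exact: integrableZl.
Qed.

End kernel_operator.

(** * The L_2 bound for mean-zero functions *)

Section L2_bound.
Context d (X : measurableType d) (R : realType).
Local Open Scope classical_set_scope.
Local Open Scope ring_scope.

Lemma limn_einf_le (u : (\bar R)^nat) (C : \bar R) : (forall n, u n <= C)%E ->
  (limn_einf u <= C)%E.
Proof.
move=> uC; rewrite limn_einf_lim; apply: lime_le; first exact: is_cvg_einfs.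
apply: nearW => n; apply: le_trans (uC n); rewrite /einfs.
by apply: ereal_inf_lbound; exists n => //=.
Qed.

Lemma integrable_sqr (mu : {finite_measure set X -> \bar R}) (f : X -> R) :
  measurable_fun [set: X] f -> (\int[mu]_x (f x ^+ 2)%:E < +oo)%E ->
  mu.-integrable [set: X] (EFin \o f).
Proof.
move=> mf foo; apply: (@le_integrable _ _ _ _ _ _ _ (EFin \o (fun x => 1 + f x ^+ 2))) => //.
- exact/measurable_EFinP.
- move=> x _; rewrite /= lee_fin [leRHS]ger0_norm ?addr_ge0 ?sqr_ge0//.
  rewrite -[f x ^+ 2]real_normK ?num_real//.
  by have := sqr_ge0 (`|f x| - 1); have := normr_ge0 (f x); nra.
- rewrite (_ : _ \o _ = (fun x => 1%:E + (f x ^+ 2)%:E)%E)//.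
  apply: integrableD => //; first exact: finite_measure_integrable_cst.
  apply/integrableP; split; first exact/measurable_EFinP/measurable_funX.
  by under eq_integral do rewrite gee0_abs ?lee_fin ?sqr_ge0//.
Qed.

Import HBSimple HBNNSimple.

(** The difference of increasing approximations of [f^\+] and [f^\-] is bounded by their sum, hence
    by |f|. Domination serves dominated convergence and keeps the L_2 norms below that of [f]. *)
Lemma dominated_sfun_approx (f : X -> R) : measurable_fun [set: X] f ->
  exists h : {sfun X >-> R}^nat, (forall k x, `|h k x| <= `|f x|) /\
    forall x, h k x @[k --> \oo] --> f x.
Proof.
move=> mf.
have mp : measurable_fun [set: X] (EFin \o f^\+).
  exact/measurable_EFinP/measurable_funrpos.
have mn : measurable_fun [set: X] (EFin \o f^\-).
  exact/measurable_EFinP/measurable_funrneg.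
pose p := nnsfun_approx measurableT mp.
pose m := nnsfun_approx measurableT mn.
have cp x : p k x @[k --> \oo] --> f^\+ x.
  have := @cvg_nnsfun_approx _ _ _ _ measurableT _ mp _ x Logic.I.
  move=> /(_ _)/fine_cvg; apply => y _; rewrite lee_fin; exact: funrpos_ge0.
have cm x : m k x @[k --> \oo] --> f^\- x.
  have := @cvg_nnsfun_approx _ _ _ _ measurableT _ mn _ x Logic.I.
  move=> /(_ _)/fine_cvg; apply => y _; rewrite lee_fin; exact: funrneg_ge0.
have lep k x : p k x <= f^\+ x.
  rewrite -(cvg_lim _ (cp x))//; apply: nondecreasing_cvgn_le.
    by move=> a b ab; exact/lefP/nd_nnsfun_approx.
  by apply/cvg_ex; exists (f^\+ x); exact: cp.
have lem k x : m k x <= f^\- x.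
  rewrite -(cvg_lim _ (cm x))//; apply: nondecreasing_cvgn_le.
    by move=> a b ab; exact/lefP/nd_nnsfun_approx.
  by apply/cvg_ex; exists (f^\- x); exact: cm.
exists (fun k => p k \+ cst (-1) \* m k); split => [k x|x] /=.
  rewrite mulN1r.
  have -> : `|f x| = f^\+ x + f^\- x by rewrite -[LHS]/((Num.Def.normr \o f) x) -funrposDneg.
  rewrite (le_trans (ler_normB _ _))// !ger0_norm//.
  exact: lerD.
have -> : f x = f^\+ x + -1 * f^\- x by rewrite -{1}(funrposBneg f) mulN1r.
by apply: cvgD => //; apply: cvgM => //; exact: cvg_cst.
Qed.

Variables (T : R.-pker X ~> X) (pi : probability X R) (n : nat) (D : R).
Hypothesis hrev : reversible T pi.
Hypothesis hD : forall x A, measurable A ->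
  `|fine (nstep T n x A) - fine (pi A)| <= D.

(** The approximants [h k] need not have mean zero, which is why [sfun_contraction] subtracts the
    mean. Their means tend to that of [f], which is 0, so the lower limit in Fatou's lemma is the
    square of T^n f. *)
Lemma iter_kernel_op_contraction (f : X -> R) : measurable_fun [set: X] f ->
  (\int[pi]_x (f x ^+ 2)%:E < +oo)%E -> \int[pi]_x f x = 0 ->
  (\int[pi]_x (iter n (kernel_op T) f x ^+ 2)%:E <=
   ((2 * D) ^+ 2)%:E * \int[pi]_x (f x ^+ 2)%:E)%E.
Proof.
move=> mf foo f0; have fi := integrable_sqr mf foo.
have [h [hf ch]] := dominated_sfun_approx mf.
have cRint (mu : {finite_measure set X -> \bar R}) :
    mu.-integrable [set: X] (EFin \o f) ->
    \int[mu]_x h k x @[k --> \oo] --> \int[mu]_x f x.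
  move=> fmu; have ffin := integrable_fin_num measurableT fmu.
  have [] := @dominated_convergence _ _ _ mu _ measurableT
    (fun k => EFin \o h k) (EFin \o f) (fun x => `|f x|%:E) => //.
  - by move=> k; exact/measurable_EFinP.
  - exact/measurable_EFinP.
  - by apply: aeW => x _; apply: cvg_EFin; [exact: nearW|exact: ch].
  - exact: integrable_norm fmu.
  - by apply: aeW => x k _ /=; rewrite lee_fin.
  by move=> _ _; rewrite -(fineK ffin) => /fine_cvg.
pose g k x := ((\int[nstep T n x]_y h k y - \int[pi]_y h k y) ^+ 2)%:E.
have mg k : measurable_fun [set: X] (g k).
  apply/measurable_EFinP; apply: measurable_funX; apply: measurable_funB => //.
  under eq_fun do rewrite Rintegral_sfun.
  apply: measurable_sum => r; apply: measurable_funM => //.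
  apply: measurableT_comp => //; apply: (measurable_kernel (kernel_iter T n)).
  exact: measurable_sfunP.
have g0 k x : (0 <= g k x)%E by rewrite lee_fin sqr_ge0.
have mt : measurable_fun [set: X] (iter n (kernel_op T) f).
  exact/(integrable_measurable (pi := pi))/integrable_iter_kernel_op.
have lim_g : {ae pi, forall x, limn_einf (g ^~ x) = (iter n (kernel_op T) f x ^+ 2)%:E}.
  apply: filterS2 (iter_kernel_opE hrev n fi) (ae_integrable_nstep hrev n fi) => x -> fx.
  apply: (cvg_limn_einf_sup _).1; apply: cvg_EFin; first exact: nearW.
  rewrite -[X in X ^+ 2]subr0 -[X in _ - X]f0.
  have cB : \int[nstep T n x]_y h k y - \int[pi]_y h k y @[k --> \oo] -->
      \int[nstep T n x]_y f y - \int[pi]_y f y.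
    by apply: cvgB; exact: cRint.
  exact: (cvgM cB cB).
have := fatou pi measurableT mg (fun k x _ => g0 k x).
have -> : (\int[pi]_x limn_einf (g ^~ x) =
           \int[pi]_x (iter n (kernel_op T) f x ^+ 2)%:E)%E.
  apply: ae_eq_integral => //.
  - under eq_fun do rewrite -[limn_einf _]oppeK -limn_esupN.
    apply: measurableT_comp => //; apply: measurable_fun_limn_esup => k.
    exact: measurableT_comp.
  - exact/measurable_EFinP/measurable_funX.
  - by apply: filterS lim_g => x E _.
move=> /le_trans; apply; apply: limn_einf_le => k.
apply: (le_trans (sfun_contraction hrev hD (h k))).
apply: lee_wpmul2l; first by rewrite lee_fin sqr_ge0.
apply: ge0_le_integral => //.
- by move=> x _; rewrite lee_fin sqr_ge0.
- exact/measurable_EFinP/measurable_funX.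
- exact/measurable_EFinP/measurable_funX.
- move=> x _; rewrite lee_fin -[leLHS]real_normK ?num_real//.
  by rewrite -[leRHS]real_normK ?num_real// lerXn2r ?nnegrE.
Qed.

End L2_bound.

(** * The space of mean-zero square-integrable functions *)

Section centered_L2.
Context d (X : measurableType d) (R : realType) (pi : probability X R).
Local Open Scope classical_set_scope.
Local Open Scope ring_scope.

(** The squared L_2 norm; roots reappear only when the resolvent is shown to be bounded. *)
Definition sqr_int (f : X -> R) : \bar R := (\int[pi]_x (f x ^+ 2)%:E)%E.

Lemma sqr_int_ge0 (f : X -> R) : (0 <= sqr_int f)%E.
Proof. by apply: integral_ge0 => x _; rewrite lee_fin sqr_ge0. Qed.

Lemma Lnorm2E (f : X -> R) :
  ('N[pi]_2%:E[EFin \o f] = sqr_int f `^ 2^-1)%E.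
Proof.
rewrite unlock /sqr_int; congr (_ `^ _)%E; apply: eq_integral => x _ /=.
by rewrite powR_mulrn// real_normK// num_real.
Qed.

Lemma L20P (f : X -> R) : L20 pi f <->
  [/\ measurable_fun [set: X] f, (sqr_int f < +oo)%E & \int[pi]_x f x = 0].
Proof.
rewrite /L20/=; split=> [[f2 f0]|[mf foo f0]]; last first.
  split => //; rewrite inE; apply/andP; split; rewrite inE//=.
  by rewrite /finite_norm Lnorm2E poweR_lty.
split => //.
  by move: f2; rewrite inE => /andP[/[!inE]].
have /integrableP[_] := Lfun2_integrable_sqr f2.
by under eq_integral do rewrite gee0_abs ?lee_fin ?sqr_ge0//.
Qed.

Lemma L20_integrable (f : X -> R) : L20 pi f -> pi.-integrable [set: X] (EFin \o f).
Proof. by move=> /L20P[mf foo _]; exact: integrable_sqr. Qed.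

Lemma L20_measurable (f : X -> R) : L20 pi f -> measurable_fun [set: X] f.
Proof. by move=> /L20P[]. Qed.

Variable T : R.-pker X ~> X.
Hypothesis hrev : reversible T pi.

(** Keeps the mean-zero condition along the iterates of [kernel_op T]. *)
Lemma Rintegral_kernel_op (f : X -> R) : pi.-integrable [set: X] (EFin \o f) ->
  \int[pi]_x kernel_op T f x = \int[pi]_x f x.
Proof.
move=> fi.
have ip := integrable_funrpos measurableT fi.
have im := integrable_funrneg measurableT fi.
have fE : f = fun x => -1 * f^\- x + f^\+ x.
  by rewrite -[LHS]funrposBneg; apply/funext => x; rewrite /= mulN1r addrC.
have nn (g : X -> R) : (forall x, 0 <= g x) ->
    pi.-integrable [set: X] (EFin \o g) ->
    \int[pi]_x kernel_op T g x = \int[pi]_x g x.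
  move=> g0 gi; rewrite /Rintegral; congr fine.
  have g0' x : (0 <= (EFin \o g) x)%E by rewrite lee_fin.
  have mg := measurable_int pi gi.
  have mT := measurable_kernel_int T mg g0'.
  have T0 := kernel_int_ge0 T g0'.
  have Too : (\int[pi]_x kernel_int T (EFin \o g) x < +oo)%E.
    by rewrite (kernel_int_stationary hrev)// integrable_lty.
  rewrite -(kernel_int_stationary hrev mg g0'); apply: ae_eq_integral => //.
    exact/measurable_EFinP/measurable_kernel_op/(integrable_measurable gi).
  apply: filterS2 (kernel_op_fine hrev mg g0' (integrable_lty measurableT gi))
    (ae_fin_num mT T0 Too) => x /= E fx _.
  by rewrite -(fineK fx) -E.
have lin := kernel_op_lin hrev (-1) im ip; rewrite -fE in lin.
have Tp := integrable_kernel_op hrev ip; have Tm := integrable_kernel_op hrev im.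
have ZE (g : X -> R) : EFin \o (fun x => -1 * g x) = fun x => ((-1)%:E * (EFin \o g) x)%E.
  by apply/funext.
transitivity (\int[pi]_x (-1 * kernel_op T f^\- x + kernel_op T f^\+ x)).
  rewrite /Rintegral; congr fine; apply: ae_eq_integral => //.
  - exact/measurable_EFinP/measurable_kernel_op/(integrable_measurable fi).
  - apply/measurable_EFinP; apply: measurable_funD.
      by apply: measurable_funM => //; exact: integrable_measurable Tm.
    exact: integrable_measurable Tp.
  - by apply: filterS lin => x -> _.
rewrite [in RHS]fE !RintegralD//; last 2 first.
- by rewrite ZE; exact: integrableZl.
- by rewrite ZE; exact: integrableZl.
by rewrite !RintegralZl// !nn.
Qed.

Lemma L20_iter_kernel_op n (f : X -> R) : L20 pi f ->
  L20 pi (iter n (kernel_op T) f) /\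
  forall D, (forall x A, measurable A ->
      `|fine (nstep T n x A) - fine (pi A)| <= D) ->
    (sqr_int (iter n (kernel_op T) f) <= ((2 * D) ^+ 2)%:E * sqr_int f)%E.
Proof.
move=> /[dup] f2 /L20P[mf foo f0]; have fi := L20_integrable f2.
have bound D (hD : forall x A, measurable A ->
      `|fine (nstep T n x A) - fine (pi A)| <= D) :
    (sqr_int (iter n (kernel_op T) f) <= ((2 * D) ^+ 2)%:E * sqr_int f)%E.
  exact: iter_kernel_op_contraction.
split=> //; apply/L20P; split.
- exact/integrable_measurable/(integrable_iter_kernel_op hrev n fi).
(* Finiteness of the norm comes from the trivial discrepancy bound [D = 1]. *)
- apply: (@le_lt_trans _ _ (((2 * 1) ^+ 2)%:E * sqr_int f)%E); last first.
    by rewrite lte_mul_pinfty// lee_fin sqr_ge0.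
  by apply: bound => x A; exact: discrepancy_le1.
- elim: n {bound} => [//|n IH] /=.
  by rewrite Rintegral_kernel_op//; exact: integrable_iter_kernel_op.
Qed.

End centered_L2.

(** * The Neumann series as inverse of T - lam *)

Section neumann_series.
Context d (X : measurableType d) (R : realType) (pi : probability X R).
Local Open Scope classical_set_scope.
Local Open Scope ring_scope.
Variables (T : R.-pker X ~> X).
Hypothesis hrev : reversible T pi.
Variables (lam q C : R).
Hypotheses (q0 : 0 < q) (qlam : q < `|lam|) (C0 : 0 <= C).
Hypothesis geometric : forall m (f : X -> R), L20 pi f ->
  (sqr_int pi (iter m (kernel_op T) f) <= (C * q ^+ (2 * m))%:E * sqr_int pi f)%E.

Let lam0 : lam != 0. Proof. by rewrite -normr_gt0; exact: lt_trans qlam. Qed.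

(** Ratio of the geometric series that majorizes the L_2 norms of the terms. *)
Let s := q / `|lam|.

Let s0 : 0 < s. Proof. by rewrite divr_gt0// normr_gt0. Qed.

Let s1 : s < 1. Proof. by rewrite ltr_pdivrMr ?mul1r// normr_gt0. Qed.

Definition neumann_term (f : X -> R) m x : R := - lam ^- m.+1 * iter m (kernel_op T) f x.

Definition neumann_sum (f : X -> R) M x : R := \sum_(0 <= m < M) neumann_term f m x.

(* limn_esup makes this measurable everywhere; it is the sum of the series
   pi-almost everywhere on L20, and a junk value elsewhere. *)
Definition neumann (f : X -> R) x := fine (limn_esup (fun M => (neumann_sum f M x)%:E)).

Lemma measurable_neumann_term (f : X -> R) m : measurable_fun [set: X] f ->
  measurable_fun [set: X] (neumann_term f m).
Proof.
move=> mf; apply: measurable_funM => //.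
by elim: m => [//|m IH]; exact: measurable_kernel_op.
Qed.

Lemma measurable_neumann_sum (f : X -> R) M : measurable_fun [set: X] f ->
  measurable_fun [set: X] (neumann_sum f M).
Proof. by move=> mf; apply: measurable_sum => m; exact: measurable_neumann_term. Qed.

Lemma measurable_neumann (f : X -> R) : measurable_fun [set: X] f ->
  measurable_fun [set: X] (neumann f).
Proof.
move=> mf; apply: measurableT_comp => //; apply: measurable_fun_limn_esup => M.
exact/measurable_EFinP/measurable_neumann_sum.
Qed.

Let sum_geometric_le M : \sum_(0 <= m < M) s ^+ m <= (1 - s)^-1.
Proof.
rewrite -[leRHS]mul1r ler_pdivlMr ?subr_gt0// big_mkord.
have := subrX1 s M; rewrite -opprB -[s - 1]opprB mulNr => /oppr_inj.
by rewrite mulrC => <-; rewrite lerBlDr lerDl exprn_ge0// ltW.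
Qed.

(** The square of [sqrt C / |lam| * \sum_m s ^+ m], which the triangle inequality in L_2 would give
    for the whole series. *)
Let B := C / (lam ^+ 2 * (1 - s) ^+ 2).

(** Cauchy-Schwarz with weights [s ^+ m] takes the place of Minkowski's inequality. The m-th squared
    norm is at most [C / lam ^+ 2 * s ^+ (2 * m)] times that of [f]; dividing by the weight leaves a
    summable [s ^+ m]. *)
Lemma sqr_int_abs_neumann_sum (f : X -> R) M : L20 pi f ->
  (sqr_int pi (fun x => (\sum_(0 <= m < M) `|neumann_term f m x|)%R) <=
   B%:E * sqr_int pi f)%E.
Proof.
move=> f2; have mf := L20_measurable f2.
have mn m := measurable_neumann_term m mf.
have sm0 m : 0 < s ^+ m by rewrite exprn_gt0.
have cs x : (\sum_(0 <= m < M) `|neumann_term f m x|) ^+ 2 <=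
    (1 - s)^-1 * \sum_(0 <= m < M) (s ^- m * neumann_term f m x ^+ 2).
  under eq_bigr => m _ do rewrite -[`|_|](mulVKf (lt0r_neq0 (sm0 m))).
  apply: (le_trans (weighted_cauchy_schwarz _ _ (fun m => ltW (sm0 m)))).
  rewrite [X in _ * X <= _](_ : _ =
      \sum_(0 <= m < M) (s ^- m * neumann_term f m x ^+ 2)); last first.
    apply: eq_bigr => m _; rewrite [(s ^- m * _) ^+ 2]exprMn real_normK ?num_real//.
    by have := lt0r_neq0 (sm0 m); move: (s ^+ m) => A A0; field.
  apply: ler_wpM2r => //; apply: sumr_ge0 => m _.
  by rewrite mulr_ge0 ?sqr_ge0// invr_ge0 ltW.
have s10 : 0 <= (1 - s)^-1 by rewrite invr_ge0 subr_ge0 ltW.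
have t0 m x : (0 <= (s ^- m * neumann_term f m x ^+ 2)%:E)%E.
  by rewrite lee_fin mulr_ge0 ?sqr_ge0// invr_ge0 ltW.
have mt m : measurable_fun [set: X] (fun x => (s ^- m * neumann_term f m x ^+ 2)%:E).
  by apply/measurable_EFinP; apply: measurable_funM => //; exact: measurable_funX.
apply: (@le_trans _ _ (\int[pi]_x ((1 - s)^-1%:E *
    \sum_(0 <= m < M) (s ^- m * neumann_term f m x ^+ 2)%:E))%E).
  apply: ge0_le_integral => //.
  - by move=> x _; rewrite lee_fin sqr_ge0.
  - apply/measurable_EFinP; apply: measurable_funX; apply: measurable_sum => m.
    exact: measurableT_comp.
  - by apply: measurable_funeM; exact: emeasurable_sum.
  - by move=> x _; rewrite sumEFin -EFinM lee_fin.
rewrite ge0_integralZl//; last 2 first.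
- exact: emeasurable_sum.
- by move=> x _; exact: sume_ge0.
rewrite ge0_integral_sum//.
apply: (@le_trans _ _ ((1 - s)^-1%:E *
    \sum_(0 <= m < M) (C / lam ^+ 2 * s ^+ m)%:E * sqr_int pi f)%E).
  rewrite lee_wpmul2l//; apply: lee_sum => m _.
  under eq_integral => x _ do
    rewrite /neumann_term [(- lam ^- m.+1 * _) ^+ 2]exprMn mulrA EFinM.
  rewrite ge0_integralZl//; last 3 first.
  - apply/measurable_EFinP; apply: measurable_funX.
    exact: (L20_measurable (L20_iter_kernel_op hrev m f2).1).
  - by move=> x _; rewrite lee_fin sqr_ge0.
  - by rewrite lee_fin mulr_ge0 ?sqr_ge0// invr_ge0 ltW.
  apply: (@le_trans _ _ ((s ^- m * (- lam ^- m.+1) ^+ 2)%:E *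
      ((C * q ^+ (2 * m))%:E * sqr_int pi f))%E).
    apply: lee_wpmul2l; last exact: geometric.
    by rewrite lee_fin mulr_ge0 ?sqr_ge0// invr_ge0 ltW.
  rewrite muleA -EFinM le_eqVlt; apply/orP; left; apply/eqP; congr (_%:E * _)%E.
  have qE : q = s * `|lam| by rewrite /s divfK// normr_eq0.
  have qm : q ^+ m = s ^+ m * `|lam ^+ m|.
    by rewrite normrX [in LHS]qE [LHS]exprMn.
  rewrite mulnC exprM qm [lam ^+ m.+1]exprS.
  have := lt0r_neq0 (sm0 m); have : lam ^+ m != 0 by rewrite expf_neq0.
  move: (s ^+ m) (lam ^+ m) => A L L0 A0.
  rewrite [(A * `|L|) ^+ 2]exprMn real_normK ?num_real//.
  by field; rewrite lam0 L0 A0.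
rewrite -ge0_sume_distrl; last first.
  by move=> m _; rewrite lee_fin mulr_ge0 ?divr_ge0 ?sqr_ge0// ltW.
rewrite muleA; apply: lee_wpmul2r; first exact: sqr_int_ge0.
rewrite sumEFin -EFinM lee_fin -mulr_sumr.
have -> : B = (1 - s)^-1 * (C / lam ^+ 2 * (1 - s)^-1).
  by rewrite /B; field; rewrite lam0 subr_eq0 gt_eqF.
rewrite ler_wpM2l// ler_wpM2l//.
by rewrite divr_ge0// sqr_ge0.
Qed.

(** Monotone convergence bounds the integral of [H], the limit of the squared sums of absolute
    values. Where [H] is finite the series converges absolutely, and the root of [H] dominates its
    partial sums. *)
Lemma neumann_dominated (f : X -> R) : L20 pi f -> exists g : X -> R,
  [/\ measurable_fun [set: X] g, (sqr_int pi g <= B%:E * sqr_int pi f)%E &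
    {ae pi, forall x, (forall M, `|neumann_sum f M x| <= g x) /\
      neumann_sum f M x @[M --> \oo] --> neumann f x}].
Proof.
move=> f2; have mf := L20_measurable f2.
have mn m := measurable_neumann_term m mf.
pose G M x := \sum_(0 <= m < M) `|neumann_term f m x|.
have G0 M x : 0 <= G M x by exact: sumr_ge0.
have ndG x : nondecreasing_seq (G ^~ x).
  move=> a b ab; rewrite /G [leRHS](@big_cat_nat _ _ _ a)//=.
  by rewrite lerDl; exact: sumr_ge0.
have mG M : measurable_fun [set: X] (G M).
  by apply: measurable_sum => m; exact: measurableT_comp.
have mG2 M : measurable_fun [set: X] (fun x => (G M x ^+ 2)%:E).
  exact/measurable_EFinP/measurable_funX.
have G20 M x : (0 <= (G M x ^+ 2)%:E)%E by rewrite lee_fin sqr_ge0.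
have ndG2 x : nondecreasing_seq (fun M => (G M x ^+ 2)%:E).
  by move=> a b ab; rewrite lee_fin lerXn2r ?nnegrE//; exact: ndG.
have fine_le (z : \bar R) : (0 <= z)%E -> ((fine z)%:E <= z)%E.
  by case: z => //= _; exact: leey.
pose H x := limn (fun M => (G M x ^+ 2)%:E).
have GH M x : ((G M x ^+ 2)%:E <= H x)%E.
  rewrite /H (cvg_lim _ (ereal_nondecreasing_cvgn (ndG2 x)))//.
  by apply: ereal_sup_ubound; exists M.
have H0 x : (0 <= H x)%E by exact: le_trans (GH 0%N x).
have mH : measurable_fun [set: X] H.
  rewrite (_ : H = fun x => limn_esup (fun M => (G M x ^+ 2)%:E)).
    exact: measurable_fun_limn_esup.
  apply/funext => x; rewrite is_cvg_limn_esupE//.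
  exact: ereal_nondecreasing_is_cvgn.
have HB : (\int[pi]_x H x <= B%:E * sqr_int pi f)%E.
  rewrite monotone_convergence//; apply: lime_le.
    apply: ereal_nondecreasing_is_cvgn => a b ab; apply: ge0_le_integral => //.
    by move=> x _; exact: ndG2.
  by apply: nearW => M; exact: sqr_int_abs_neumann_sum.
have Hoo : (\int[pi]_x H x < +oo)%E.
  apply: (le_lt_trans HB); rewrite lte_mul_pinfty//.
  - by rewrite lee_fin divr_ge0// mulr_ge0 ?sqr_ge0.
  - by move/L20P : f2 => [].
have msH : measurable_fun [set: X] (fun x => Num.sqrt (fine (H x))).
  apply: (@measurableT_comp _ _ _ _ _ _ (@Num.sqrt R)); last exact: measurableT_comp.
  by apply: continuous_measurable_fun; exact: sqrt_continuous.
(* Where [H x] is infinite, [fine] returns 0 and there is no domination; this set is null. *)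
exists (fun x => Num.sqrt (fine (H x))); split.
- exact: msH.
- apply: le_trans HB; apply: ge0_le_integral => //.
  + exact/measurable_EFinP/measurable_funX.
  + move=> x _; rewrite sqr_sqrtr ?fine_ge0//.
    exact: fine_le.
- apply: filterS (ae_fin_num mH H0 Hoo) => x Hx.
  have Gg M : G M x <= Num.sqrt (fine (H x)).
    rewrite -(ger0_norm (G0 M x)) -sqrtr_sqr ler_wsqrtr//.
    by rewrite -lee_fin fineK.
  split=> [M|]; first exact: le_trans (ler_norm_sum _ _ _) (Gg M).
  have cs : cvgn (neumann_sum f ^~ x).
    apply: (@normed_cvg _ _ (neumann_term f ^~ x)).
    apply: nondecreasing_is_cvgn; first exact: ndG.
    by exists (Num.sqrt (fine (H x))) => _ [M _ <-]; exact: Gg.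
  rewrite /neumann (cvg_limn_einf_sup (_ : _ --> (limn (neumann_sum f ^~ x))%:E)).2//.
  by apply: cvg_EFin; [exact: nearW|exact: cs].
Qed.

(** The measure is left general for two uses: [pi], to see that the sum has mean zero, and [T x], to
    apply [T] term by term. *)
Lemma cvg_Rintegral_neumann_sum (mu : {measure set X -> \bar R}) (f g : X -> R) :
  measurable_fun [set: X] f -> mu.-integrable [set: X] (EFin \o g) ->
  {ae mu, forall x, (forall M, `|neumann_sum f M x| <= g x) /\
      neumann_sum f M x @[M --> \oo] --> neumann f x} ->
  \int[mu]_x neumann_sum f M x @[M --> \oo] --> \int[mu]_x neumann f x.
Proof.
move=> mf gi fg.
have [] := @dominated_convergence _ _ _ mu _ measurableT
    (fun M => EFin \o neumann_sum f M) (EFin \o neumann f) (EFin \o g) => //.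
- by move=> M; exact/measurable_EFinP/measurable_neumann_sum.
- exact/measurable_EFinP/measurable_neumann.
- by apply: filterS fg => x [_ cx] _; apply: cvg_EFin; [exact: nearW|exact: cx].
- by apply: filterS fg => x [bx _] M _ /=; rewrite lee_fin.
move=> Ni _ Nc.
have Nfin := integrable_fin_num measurableT Ni.
by move: Nc; rewrite -(fineK Nfin) => /fine_cvg.
Qed.

Lemma neumann_sumS (f : X -> R) M x : neumann_sum f M.+1 x =
  - lam ^- M.+1 * iter M (kernel_op T) f x + neumann_sum f M x.
Proof. by rewrite /neumann_sum big_nat_recr//= addrC. Qed.

Lemma neumann_sum_L1 (f : X -> R) M : L20 pi f ->
  pi.-integrable [set: X] (EFin \o neumann_sum f M) /\
  \int[pi]_x neumann_sum f M x = 0.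
Proof.
move=> f2; elim: M => [|M [IHi IH0]].
  have -> : neumann_sum f 0 = cst 0 by apply/funext => x; rewrite /neumann_sum big_nil.
  by split; [exact: finite_measure_integrable_cst|rewrite Rintegral_cst// mul0r].
have tM := (L20_iter_kernel_op hrev M f2).1.
have ti := L20_integrable tM; have /L20P[_ _ t0] := tM.
have -> : neumann_sum f M.+1 = fun x =>
    - lam ^- M.+1 * iter M (kernel_op T) f x + neumann_sum f M x.
  by apply/funext => x; rewrite neumann_sumS.
have Zi : pi.-integrable [set: X]
    (EFin \o (fun x => - lam ^- M.+1 * iter M (kernel_op T) f x)).
  rewrite (_ : _ \o _ = fun x => (- lam ^- M.+1)%:E *
    (EFin \o iter M (kernel_op T) f) x)%E//; exact: integrableZl.
split; last by rewrite RintegralD// RintegralZl// t0 IH0 mulr0 addr0.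
rewrite (_ : _ \o _ = (EFin \o (fun x => - lam ^- M.+1 * iter M (kernel_op T) f x)%R)
  \+ (EFin \o neumann_sum f M))%E//; exact: integrableD.
Qed.

Lemma L20_neumann (f : X -> R) : L20 pi f -> L20 pi (neumann f) /\
  (sqr_int pi (neumann f) <= B%:E * sqr_int pi f)%E.
Proof.
move=> f2; have mf := L20_measurable f2.
have [g [mg gB fg]] := neumann_dominated f2.
have mN := measurable_neumann mf.
have NB : (sqr_int pi (neumann f) <= B%:E * sqr_int pi f)%E.
  apply: le_trans gB; apply: ae_ge0_le_integral => //.
  - by move=> x _; rewrite lee_fin sqr_ge0.
  - exact/measurable_EFinP/measurable_funX.
  - by move=> x _; rewrite lee_fin sqr_ge0.
  - exact/measurable_EFinP/measurable_funX.
  - apply: filterS fg => x [bx cx] _.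
    have Nx : `|neumann f x| <= g x.
      by apply: (cvgr_to_le (cvg_norm cx)); exact: nearW.
    rewrite lee_fin -[leLHS]real_normK ?num_real// lerXn2r ?nnegrE//.
    exact: le_trans Nx.
have Boo : (B%:E * sqr_int pi f < +oo)%E.
  rewrite lte_mul_pinfty//.
  - by rewrite lee_fin divr_ge0// mulr_ge0 ?sqr_ge0.
  - by move/L20P : f2 => [].
split => //; apply/L20P; split => //; first exact: le_lt_trans Boo.
have gi : pi.-integrable [set: X] (EFin \o g).
  by apply: integrable_sqr => //; exact: le_lt_trans Boo.
(* All partial sums have mean zero, and dominated convergence transfers this to the limit. *)
have := cvg_Rintegral_neumann_sum mf gi fg.
under eq_fun => M do rewrite (neumann_sum_L1 M f2).2.
by move=> N0; exact: (cvg_unique _ N0 (cvg_cst 0)).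
Qed.

(** [T] maps each term to [lam] times the next one. The term of index 0, which is not reached,
    equals [- f / lam] and accounts for [f x]. *)
Lemma kernel_op_neumann_sum (f : X -> R) M : L20 pi f ->
  {ae pi, forall x, kernel_op T (neumann_sum f M) x =
    lam * neumann_sum f M.+1 x + f x}.
Proof.
move=> f2; elim: M => [|M IH].
  apply: aeW => x; rewrite neumann_sumS /neumann_sum big_nil /kernel_op.
  under eq_Rintegral do rewrite big_nil.
  rewrite Rintegral_cst// mul0r addr0 /= expr1.
  by field.
have -> : neumann_sum f M.+1 = fun x =>
    - lam ^- M.+1 * iter M (kernel_op T) f x + neumann_sum f M x.
  by apply/funext => x; rewrite neumann_sumS.
have ti := L20_integrable (L20_iter_kernel_op hrev M f2).1.
apply: filterS2 (kernel_op_lin hrev (- lam ^- M.+1) ti (neumann_sum_L1 M f2).1) IH.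
move=> x -> ->; rewrite (neumann_sumS _ M.+1) /=.
rewrite [lam ^+ M.+2]exprS; have : lam ^+ M.+1 != 0 by rewrite expf_neq0.
by move: (lam ^+ M.+1) => L L0; field; rewrite lam0 L0.
Qed.

(** Limit of [kernel_op_neumann_sum]. By [ae_kernel] the domination also holds [T x]-almost
    everywhere for almost every [x], which allows dominated convergence under [T x]. *)
Lemma kernel_op_neumann (f : X -> R) : L20 pi f ->
  {ae pi, forall x, kernel_op T (neumann f) x - lam * neumann f x = f x}.
Proof.
move=> f2; have mf := L20_measurable f2.
have [g [mg gB fg]] := neumann_dominated f2.
have gi : pi.-integrable [set: X] (EFin \o g).
  apply: integrable_sqr => //; apply: (le_lt_trans gB); rewrite lte_mul_pinfty//.
  - by rewrite lee_fin divr_ge0// mulr_ge0 ?sqr_ge0.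
  - by move/L20P : f2 => [].
have Tfg := ae_kernel hrev fg.
have TE : {ae pi, forall x, forall M, kernel_op T (neumann_sum f M) x =
    lam * neumann_sum f M.+1 x + f x}.
  by apply: ae_foralln => M; exact: kernel_op_neumann_sum.
have Tg : {ae pi, forall x, (T x).-integrable [set: X] (EFin \o g) /\
    {ae T x, forall y, (forall M, `|neumann_sum f M y| <= g y) /\
      neumann_sum f M y @[M --> \oo] --> neumann f y}}.
  by apply: filterS2 (ae_integrable_kernel hrev gi) Tfg => x.
apply: filterS3 fg TE Tg => x [_ cx] Ex [gx fgx].
have Tc := cvg_Rintegral_neumann_sum mf gx fgx.
have cE : lam * neumann_sum f M.+1 x + f x @[M --> \oo] --> lam * neumann f x + f x.
  apply: cvgD; last exact: cvg_cst.
  by apply: cvgM; [exact: cvg_cst|rewrite (cvg_shiftS (neumann_sum f ^~ x))].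
have TcE : (fun M => \int[T x]_y neumann_sum f M y) =
    (fun M => lam * neumann_sum f M.+1 x + f x).
  by apply/funext => M; exact: Ex.
rewrite TcE in Tc.
have : kernel_op T (neumann f) x = lam * neumann f x + f x.
  exact: (cvg_unique _ Tc cE).
by move=> ->; rewrite addrC addKr.
Qed.

Lemma neumannE (f : X -> R) x l : neumann_sum f M x @[M --> \oo] --> l ->
  neumann f x = l.
Proof.
move=> fl; rewrite /neumann (cvg_limn_einf_sup (_ : _ --> l%:E)).2//.
by apply: cvg_EFin; [exact: nearW|exact: fl].
Qed.

(** The partial sums telescope to [f x] plus [lam] times the difference of two consecutive partial
    sums for [f], which tends to 0. *)
Lemma neumann_kernel_op (f : X -> R) : L20 pi f ->
  {ae pi, forall x, neumann (kernel_op T f - lam *: f) x = f x}.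
Proof.
move=> f2; have fi := L20_integrable f2.
have [g [mg gB fg]] := neumann_dominated f2.
have hE : kernel_op T f - lam *: f = fun x => - lam * f x + kernel_op T f x.
  by apply/funext => x; rewrite mulNr addrC.
have th : {ae pi, forall x, forall m, iter m (kernel_op T) (kernel_op T f - lam *: f) x =
    - lam * iter m (kernel_op T) f x + iter m.+1 (kernel_op T) f x}.
  apply: ae_foralln => m; rewrite hE.
  apply: filterS (iter_kernel_op_lin hrev m (- lam) fi (integrable_kernel_op hrev fi)).
  by move=> x; rewrite -iterSr.
apply: filterS2 fg th => x [_ cx] tx.
have NS M : neumann_sum (kernel_op T f - lam *: f) M x =
    f x + lam * (neumann_sum f M.+1 x - neumann_sum f M x).
  elim: M => [|M IH].
    rewrite neumann_sumS /neumann_sum !big_nil /= expr1; by field.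
  rewrite neumann_sumS IH tx (neumann_sumS f M.+1) (neumann_sumS f M) /=.
  rewrite [lam ^+ M.+2]exprS; have : lam ^+ M.+1 != 0 by rewrite expf_neq0.
  by move: (lam ^+ M.+1) => L L0; field; rewrite lam0 L0.
apply: neumannE; under eq_fun do rewrite NS.
suff : f x + lam * (neumann_sum f M.+1 x - neumann_sum f M x) @[M --> \oo] -->
    f x + lam * (neumann f x - neumann f x) by rewrite subrr mulr0 addr0.
apply: cvgD; first exact: cvg_cst.
apply: cvgM; first exact: cvg_cst.
by apply: cvgB => //; rewrite (cvg_shiftS (neumann_sum f ^~ x)).
Qed.

(** An upper limit is not linear in general; the identity is read off where both series converge. *)
Lemma neumann_lin (a : R) (f g : X -> R) : L20 pi f -> L20 pi g ->
  {ae pi, forall x, neumann (a *: f + g) x = a * neumann f x + neumann g x}.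
Proof.
move=> f2 g2.
have [u [_ _ cf]] := neumann_dominated f2; have [v [_ _ cg]] := neumann_dominated g2.
have th : {ae pi, forall x, forall m, iter m (kernel_op T) (a *: f + g) x =
    a * iter m (kernel_op T) f x + iter m (kernel_op T) g x}.
  apply: ae_foralln => m.
  exact: (iter_kernel_op_lin hrev m a (L20_integrable f2) (L20_integrable g2)).
apply: filterS3 cf cg th => x [_ cfx] [_ cgx] tx.
apply: neumannE.
have -> : (fun M => neumann_sum (a *: f + g) M x) =
    (fun M => a * neumann_sum f M x + neumann_sum g M x).
  apply/funext; elim=> [|M IH]; first by rewrite /neumann_sum !big_nil mulr0 addr0.
  by rewrite !neumann_sumS IH tx; ring.
by apply: cvgD => //; apply: cvgM => //; exact: cvg_cst.
Qed.

Lemma resolvent_setP : resolvent_set T pi lam.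
Proof.
exists neumann; last first.
  move=> f f2; split.
  - by apply: filterS (neumann_kernel_op f2) => x -> _.
  - by apply: filterS (kernel_op_neumann f2) => x + _.
split.
- by move=> f /L20_neumann[].
- by move=> a f g f2 g2; apply: filterS (neumann_lin a f2 g2) => x + _.
- exists (B `^ 2^-1) => f f2; rewrite !Lnorm2E -poweR_EFin -poweRM//; last 2 first.
  + by rewrite lee_fin divr_ge0// mulr_ge0 ?sqr_ge0.
  + exact: sqr_int_ge0.
  apply: gt0_ler_poweR => //; last exact: (L20_neumann f2).2.
  + by rewrite in_itv/= leey andbT sqr_int_ge0.
  + rewrite in_itv/= leey andbT mule_ge0// ?sqr_int_ge0//.
    by rewrite lee_fin divr_ge0// mulr_ge0 ?sqr_ge0.
Qed.

End neumann_series.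

(** * From discrepancy bounds to the spectral radius *)

Section spectral_radius_bound.
Context d (X : measurableType d) (R : realType).
Local Open Scope classical_set_scope.
Local Open Scope ring_scope.
Variables (T : R.-pker X ~> X) (pi : probability X R).
Hypothesis hrev : reversible T pi.

Lemma sup_tvP n (D : R) : (sup_tv T pi n <= D%:E)%E -> forall x A, measurable A ->
  `|fine (nstep T n x A) - fine (pi A)| <= D.
Proof.
move=> nD x A mA; rewrite -lee_fin; apply: le_trans nD.
apply: (@le_trans _ _ (tv_norm (nstep_sub T pi n x))); last first.
  by apply: ereal_sup_ubound; exists x.
apply: ereal_sup_ubound; exists A => //.
have -> : nstep_sub T pi n x A = (fine (nstep T n x A) - fine (pi A))%:E; last by [].
by rewrite EFinB !fineK// fin_num_measure.
Qed.

(** Remove blocks of [n] steps from [m]: each multiplies the squared norm by at most [q ^+ (2 * n)],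
    until fewer than [n] steps remain. *)
Lemma geometric_decay n (D q : R) : (0 < n)%N -> 0 < q -> 0 <= D -> 2 * D <= q ^+ n ->
  (forall x A, measurable A -> `|fine (nstep T n x A) - fine (pi A)| <= D) ->
  exists2 C, 0 <= C & forall m (f : X -> R), L20 pi f ->
  (sqr_int pi (iter m (kernel_op T) f) <= (C * q ^+ (2 * m))%:E * sqr_int pi f)%E.
Proof.
move=> n0 q0 D0 Dq hD.
have qm m : 0 < q ^+ m by rewrite exprn_gt0.
have C0 : 0 <= 4 * \sum_(r < n) q ^- (2 * r).
  by rewrite mulr_ge0// sumr_ge0// => r _; rewrite invr_ge0 ltW.
(* The 4 is [(2 * D) ^+ 2] for the trivial [D = 1]; the sum stands in for the maximum of
   [q ^- (2 * r)] over the possible remainders [r]. *)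
exists (4 * \sum_(r < n) q ^- (2 * r)) => //; set C := 4 * _ in C0 *.
have D1 r x A : measurable A -> `|fine (nstep T r x A) - fine (pi A)| <= 1.
  exact: discrepancy_le1.
elim/ltn_ind => m IH f f2; have [mn|nm] := ltnP m n.
  apply: (le_trans ((L20_iter_kernel_op hrev m f2).2 1 (D1 m))).
  rewrite lee_wpmul2r ?sqr_int_ge0// lee_fin -ler_pdivrMr// /C (bigD1 (Ordinal mn))//=.
  rewrite mulr1 (_ : 2 ^+ 2 = 4); last by ring.
  rewrite ler_wpM2l// lerDl sumr_ge0// => r _.
  by rewrite invr_ge0 ltW.
have mnn : (m - n < m)%N by rewrite ltn_subrL n0 (leq_trans n0 nm).
rewrite -{1}(subnKC nm) iterD.
have t2 := (L20_iter_kernel_op hrev (m - n) f2).1.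
apply: (le_trans ((L20_iter_kernel_op hrev n t2).2 D hD)).
apply: (@le_trans _ _ ((q ^+ n ^+ 2)%:E *
    ((C * q ^+ (2 * (m - n)))%:E * sqr_int pi f))%E).
  apply: lee_pmul; rewrite ?lee_fin ?sqr_ge0 ?sqr_int_ge0//; last exact: IH.
  by rewrite lerXn2r ?nnegrE ?mulr_ge0// ltW.
rewrite muleA -EFinM lee_wpmul2r ?sqr_int_ge0// lee_fin mulrCA -exprM mulnC -exprD.
by rewrite -mulnDr subnKC.
Qed.

Lemma exists_nth_root n (c : R) : (0 < n)%N -> 0 <= c ->
  exists2 a, 0 <= a & a ^+ n = c.
Proof.
move=> n0 c0; exists (c `^ n%:R^-1); first exact: powR_ge0.
by rewrite -powR_mulrn ?powR_ge0// -powRrM mulVf ?powRr1// pnatr_eq0 -lt0n.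
Qed.

Lemma spectrum_bound n (D lam : R) : (0 < n)%N -> 0 <= D ->
  (forall x A, measurable A -> `|fine (nstep T n x A) - fine (pi A)| <= D) ->
  spectrum T pi lam -> `|lam| ^+ n <= 2 * D.
Proof.
move=> n0 D0 hD; apply: contraPle => Dlam; apply.
have [a a0 an] := exists_nth_root n0 (mulr_ge0 (ler0n R 2) D0).
have alam : a < `|lam| by rewrite -(ltr_pXn2r n0) ?nnegrE// an.
(* The midpoint lies strictly below [|lam|], and it is positive even when [D], hence [a], is 0. *)
pose q := (a + `|lam|) / 2.
have aq : a < q by rewrite /q; lra.
have qlam : q < `|lam| by rewrite /q; lra.
have q0 : 0 < q by exact: le_lt_trans aq.
have Dq : 2 * D <= q ^+ n by rewrite -an lerXn2r ?nnegrE// ltW.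
have [C C0 geo] := geometric_decay n0 q0 D0 Dq hD.
exact: (resolvent_setP hrev q0 qlam C0 geo).
Qed.

(** Without a supremum, [sup] returns its default 0; otherwise the radius is at least some
    [|lam|]. *)
Lemma spectral_radius_ge0 : 0 <= spectral_radius T pi.
Proof.
have [[[r [lam Slam lamr]] ub]|] := pselect
    (has_sup [set `|lam| | lam in spectrum T pi]); last first.
  by move=> /sup_out; rewrite /spectral_radius => ->.
by apply: (@le_trans _ _ `|lam|) => //; apply: (ub_le_sup ub); exists lam.
Qed.

Lemma spectral_radius_bound n (D : R) : (0 < n)%N -> 0 <= D ->
  (sup_tv T pi n <= D%:E)%E -> spectral_radius T pi ^+ n <= 2 * D.
Proof.
move=> n0 D0 /sup_tvP hD.
have [S0|/set0P Sn0] := eqVneq [set `|lam| | lam in spectrum T pi] set0.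
  by rewrite /spectral_radius S0 sup0 expr0n eqn0Ngt n0 mulr_ge0.
have [a a0 an] := exists_nth_root n0 (mulr_ge0 (ler0n R 2) D0).
rewrite -an lerXn2r ?nnegrE ?spectral_radius_ge0//.
apply: ge_sup => //.
move=> _ [lam lams <-]; rewrite -(ler_pXn2r n0) ?nnegrE// an.
exact: spectrum_bound lams.
Qed.

(** Ensures that the minimum in [mixing_time] exists, so that its default value 0 is never taken. *)
Lemma uniformly_ergodic_mixed (eps : R) : 0 < eps -> uniformly_ergodic T pi ->
  exists n, mixed T pi eps n.
Proof.
move=> e0 /fine_cvgP[fin cv].
have : \forall n \near \oo, mixed T pi eps n.
  near=> n; apply/andP; split; first by near: n; exact: nbhs_infty_gt.
  have nfin : sup_tv T pi n \is a fin_num by near: n.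
  rewrite -(fineK nfin) lee_fin; near: n.
  exact: cvgr_le cv _ e0.
by move=> [N _ HN]; exists N; apply: HN => /=.
Unshelve. all: by end_near. Qed.

End spectral_radius_bound.

Local Open Scope ring_scope.

Theorem theorem1 (R : realType) (d : measure_display) (X : measurableType d)
    (T : R.-pker X ~> X) (pi : probability X R) (eps : R)
    (hX : countably_generated X)
    (hstat : stationary T pi)
    (herg : uniformly_ergodic T pi)
    (hrev : reversible T pi)
    (heps : 0 < eps < 2^-1) :
  0 <= spectral_radius T pi < 1 /\
  (if spectral_radius T pi == 0 then (0 < mixing_time T pi eps)%N
   else ln (2 * eps) / ln (spectral_radius T pi) <= (mixing_time T pi eps)%:R).
Proof.
have /andP[e0 e1] := heps.
have mix : mixed T pi eps (mixing_time T pi eps).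
  rewrite /mixing_time; case: pselect => [h|/(_ (uniformly_ergodic_mixed e0 herg))//].
  by case: ex_minnP.
have /andP[n0 tvn] := mix.
have := spectral_radius_bound hrev n0 (ltW e0) tvn.
have := spectral_radius_ge0 T pi.
move: (mixing_time T pi eps) n0 => n n0; set rho := spectral_radius T pi => r0 rn.
(* If [rho] were at least 1, then 1 <= rho^n <= 2 eps, contradicting eps < 1/2. *)
have r1 : rho < 1.
  rewrite ltNge; apply/negP => r1; have := exprn_ege1 n r1.
  by rewrite leNgt => /negP; apply; apply: (le_lt_trans rn); lra.
split; first by rewrite r0.
case: eqVneq => // rho0; have rp : 0 < rho by rewrite lt0r rho0.
(* Since [ln rho] is negative, clearing the denominator reverses the inequality, which becomes the
   logarithm of rho^n <= 2 eps. *)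
rewrite ler_ndivrMr; last by rewrite ln_lt0// rp.
rewrite [_ * ln rho]mulr_natl -lnXn// ler_ln ?posrE ?exprn_gt0//; lra.
Qed.
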